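(* Let $\Omega$ be a locally compact Hausdorff space with countable base and let $\sigma\in\mathcal{M}^+(\Omega)$. Suppose $G\colon\Omega\times\Omega\to[0,+\infty]$ is a lower semicontinuous quasi-symmetric kernel which satisfies the weak maximum principle. Then the following statements (1)–(3) are equivalent: (1) There exists a positive constant $c$ such that $\|\mathbf{G}\nu\|_{L^{1,\infty}(\sigma)}\le c\,\|\nu\|$ for all $\nu\in\mathcal{M}^+(\Omega)$. (2) For every $1<p<+\infty$ there exists a positive constant $c$ such that $\|\mathbf{G}(f\,d\sigma)\|_{L^p(\sigma)}\le c\,\|f\|_{L^p(\sigma)}$ for all $f\in L^p(\Omega,\sigma)$. (3) There exists a positive constant $c$ such that $\iint_{K\times K}G(x,y)\,d\sigma(x)\,d\sigma(y)\le c\,\sigma(K)$ for all compact sets $K\subset\Omega$. If, moreover, $G$ is a quasi-metric kernel, then each of (1)–(3) is also equivalent to: (4) There exists a positive constant $c$ such that $\iint_{B\times B}G(x,y)\,d\sigma(x)\,d\sigma(y)\le c\,\sigma(B)$ for all quasi-metric balls $B=B(x,r)=\{y\in\Omega\colon d(x,y)<r\}$, $x\in\Omega$, $r>0$, where $d(x,y)=\frac{1}{G(x,y)}$.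
   Context: $\mathcal{M}^+(\Omega)$ is the class of nonnegative, locally finite Borel (Radon) measures on $\Omega$; $\|\nu\|=\nu(\Omega)$; $S_\nu$ is the support of $\nu$. $\mathbf{G}\nu(x)=\int_\Omega G(x,y)\,d\nu(y)$ and $\mathbf{G}(f\,d\sigma)(x)=\int_\Omega G(x,y)f(y)\,d\sigma(y)$. $\|f\|_{L^{1,\infty}(\sigma)}=\sup_{t>0}t\,\sigma(\{|f|>t\})$. $G$ is quasi-symmetric if there is a constant $a>0$ with $a^{-1}G(y,x)\le G(x,y)\le a\,G(y,x)$ for all $x,y\in\Omega$. $G$ satisfies the weak maximum principle (with constant $h\ge1$) if, for every constant $M>0$ and every $\nu\in\mathcal{M}^+(\Omega)$, the inequality $\mathbf{G}\nu(x)\le M$ for all $x\in S_\nu$ implies $\mathbf{G}\nu(x)\le hM$ for all $x\in\Omega$. $G$ is a quasi-metric kernel with constant $\kappa>0$ if $G$ is symmetric and $d(x,y)=1/G(x,y)$ takes values in $[0,+\infty)$, is not identically zero, and satisfies $d(x,y)\le\kappa[d(x,z)+d(z,y)]$ for all $x,y,z\in\Omega$.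
   Formalization: Condition (4) additionally requires every quasi-metric ball to have finite σ-measure; otherwise (4) holds as ∞ ≤ ∞ while (3) fails, e.g. Ω = ℝ, σ = Lebesgue measure, G ≡ 1. *)

(* Defs.v *)
From HB Require Import structures.
From mathcomp Require Import all_boot all_order all_algebra.
From mathcomp Require Import all_classical all_reals all_analysis.

Set Implicit Arguments.
Unset Strict Implicit.
Unset Printing Implicit Defensive.

Import Order.TTheory GRing.Theory Num.Theory.
Import numFieldNormedType.Exports.

Local Open Scope classical_set_scope.
Local Open Scope ring_scope.
Local Open Scope ereal_scope.

(* T with its Borel sigma-algebra; the carrier is convertible to T. *)
Notation borel T := (g_sigma_algebraType (@open T)).

Section potentials.
Context {T : ptopologicalType} {R : realType}.
Implicit Types (mu nu sigma : {measure set (borel T) -> \bar R})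
  (G : T -> T -> \bar R) (f : borel T -> R).

(* On a locally compact Hausdorff second countable space, this is the same as
   being finite on compact sets, and such a Borel measure is Radon. *)
Definition locally_finite mu :=
  forall x : T, exists U : set T, [/\ open U, U x & mu U < +oo].

Definition msupport mu : set T :=
  [set x | forall U : set T, open U -> U x -> 0 < mu U].

Definition potential G nu (x : borel T) : \bar R := \int[nu]_y G x y.

(* Where the positive and negative parts of the integral are both infinite,
   the library's convention makes the value -oo, hence its modulus +oo. *)
Definition potential_density G sigma f (x : borel T) : \bar R :=
  \int[sigma]_y (G x y * (f y)%:E).

Definition weak_L1_norm sigma (u : borel T -> \bar R) : \bar R :=
  ereal_sup [set t%:E * sigma [set x | t%:E < `|u x|]
            | t in [set t : R | (0 < t)%R]].

Definition quasi_symmetric G :=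
  exists2 a : R, (0 < a)%R &
    forall x y, a^-1%:E * G y x <= G x y /\ G x y <= a%:E * G y x.

Definition weak_maximum_principle G (h : R) :=
  forall (M : R) nu, (0 < M)%R -> locally_finite nu ->
    (forall x, msupport nu x -> potential G nu x <= M%:E) ->
    forall x, potential G nu x <= (h * M)%:E.

(* Extended inverse: 0^-1 = +oo and +oo^-1 = 0. *)
Definition kernel_dist G (x y : T) : \bar R := (G x y)^-1.

Definition quasi_metric_kernel G (kappa : R) :=
  [/\ forall x y, G x y = G y x,
      forall x y, 0 <= kernel_dist G x y < +oo,
      exists x y, kernel_dist G x y != 0 &
      forall x y z, kernel_dist G x y <=
        kappa%:E * (kernel_dist G x z + kernel_dist G z y)].

Definition quasi_metric_ball G (x : T) (r : R) : set T :=
  [set y | kernel_dist G x y < r%:E].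

Definition energy G sigma (A : set T) : \bar R :=
  \int[sigma]_(y in A) \int[sigma]_(x in A) G x y.

Definition weak_type_bound G sigma :=
  exists2 c : R, (0 < c)%R & forall nu, locally_finite nu ->
    weak_L1_norm sigma (potential G nu) <= c%:E * nu [set: borel T].

Definition strong_type_bound G sigma :=
  forall p : R, (1 < p)%R -> exists2 c : R, (0 < c)%R &
    forall f, f \in Lfun sigma p%:E ->
      'N[sigma]_p%:E[potential_density G sigma f] <=
        c%:E * 'N[sigma]_p%:E[EFin \o f].

Definition energy_bound_on_compacts G sigma :=
  exists2 c : R, (0 < c)%R & forall K : set T, compact K ->
    energy G sigma K <= c%:E * sigma K.

Definition energy_bound_on_balls G sigma :=
  exists2 c : R, (0 < c)%R & forall (x : T) (r : R), (0 < r)%R ->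
    energy G sigma (quasi_metric_ball G x r) <=
      c%:E * sigma (quasi_metric_ball G x r).

(* Without this, energy_bound_on_balls is vacuous on balls of infinite measure:
   for G = 1 and sigma the Lebesgue measure on the line, the balls are the empty
   set and the whole line, so it holds, while energy_bound_on_compacts fails.
   For a quasi-metric kernel energy_bound_on_compacts implies it: if K is a
   compact subset of the ball of radius r, then G >= (2 * kappa * r)^-1 on
   K x K, so that sigma K <= 2 * kappa * c * r. *)
Definition finite_on_balls G sigma :=
  forall (x : T) (r : R), (0 < r)%R -> sigma (quasi_metric_ball G x r) < +oo.

End potentials.

(* Main.v *)
(* Energy bounds and the weak (1,1) bound are exchanged through one device. If
   the energy of a compact set K is at most c sigma(K), then on a closed half F
   of K the potential of K is at most 2c, so by the maximum principle the
   potential of F is bounded everywhere; integrating a potential G nu that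
   exceeds t on K against sigma restricted to F and exchanging the integrals
   gives t sigma(K) <= C |nu|.

   For the strong bounds let u = G(f dsigma). The maximum principle bounds the
   potential of f restricted to {u <= t} by h t, so the weak bound applied to f
   restricted to {u > t} gives the Doob-type inequality
     t sigma{u > 2 h t} <= c int_{u > t} f dsigma,
   which is summed over geometric levels as in Marcinkiewicz interpolation.

   For a quasi-metric kernel, testing on balls gives sigma(B(x,r)) <= C r, hence
   every point has many doubling scales, and non-doubling scales contribute a
   bounded amount to a potential. For E bounded and u the potential of E, a
   Vitali covering by doubling balls contained in {u > t} yields
     t sigma{u > A t} <= C sigma{u > t}    for t >= t0,
   t0 not depending on E. Together with the weak bound in terms of the energy
   constant N, this bounds the energy of E by (C + C' N / t) sigma(E); taking t
   large absorbs N. Truncating the kernel near the diagonal makes N finite, and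
   N is compared between balls of radii r and 2 kappa r, since {u > t} may leave
   the ball containing E. *)

Require Import Defs.
From HB Require Import structures.
From mathcomp Require Import all_boot all_order all_algebra.
From mathcomp Require Import all_classical all_reals all_analysis.
From mathcomp Require Import measurable_realfun.
From mathcomp Require Import ring lra.

Set Implicit Arguments.
Unset Strict Implicit.
Unset Printing Implicit Defensive.

Import Order.TTheory GRing.Theory Num.Theory.
Import numFieldNormedType.Exports.

Local Open Scope classical_set_scope.
Local Open Scope ring_scope.
Local Open Scope ereal_scope.

(** * Measures with density *)

Section integral_lemmas.
Context d (X : measurableType d) (R : realType).
Variable mu : {measure set X -> \bar R}.

Import HBNNSimple.

(* Unlike [ge0_le_integral], no measurability is required. *)
Lemma ge0_le_integralW (D : set X) (f g : X -> \bar R) :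
  (forall x, D x -> 0 <= f x) -> (forall x, D x -> f x <= g x) ->
  \int[mu]_(x in D) f x <= \int[mu]_(x in D) g x.
Proof.
move=> f0 fg.
have g0 x : D x -> 0 <= g x by move=> Dx; exact: le_trans (f0 _ Dx) (fg _ Dx).
rewrite !ge0_integralE//; apply: le_ereal_sup => _ [h hf <-]; exists h => //.
move=> x; apply: le_trans (hf x) _.
by rewrite /patch; case: ifPn => // /[!inE]; exact: fg.
Qed.

Lemma measureS (A B : set X) : measurable A -> measurable B -> A `<=` B ->
  mu A <= mu B.
Proof. by move=> mA mB AB; apply: le_measure; rewrite ?inE. Qed.

Lemma markov_ge0 (D A : set X) (f : X -> \bar R) (t : R) :
  measurable D -> measurable A -> measurable_fun D f ->
  (forall x, D x -> 0 <= f x) -> A `<=` D -> (0 <= t)%R ->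
  (forall x, A x -> t%:E <= f x) -> t%:E * mu A <= \int[mu]_(x in D) f x.
Proof.
move=> mD mA mf f0 AD t0 tf.
rewrite -integral_cst//; apply: (@le_trans _ _ (\int[mu]_(x in A) f x)).
  by apply: ge0_le_integralW => x Ax; [rewrite lee_fin|exact: tf].
exact: ge0_subset_integral.
Qed.

Section density.
Variable f : X -> R.
Hypotheses (f0 : forall x, (0 <= f x)%R) (mf : measurable_fun [set: X] f).

(** The two facts about [f] are arguments so that the measure structure declared below can recover
    them from the term. *)
Definition mdensity of (forall x, (0 <= f x)%R) & measurable_fun [set: X] f :=
  fun A : set X => \int[mu]_(x in A) (f x)%:E.

Local Notation nu := (mdensity f0 mf).

Let nu0 : nu set0 = 0. Proof. exact: integral_set0. Qed.

Let nu_ge0 A : 0 <= nu A.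
Proof. by apply: integral_ge0 => x _; rewrite lee_fin. Qed.

Let nu_sigma_additive : semi_sigma_additive nu.
Proof.
move=> F mF tF mU; rewrite /mdensity ge0_integral_bigcup//; last 2 first.
  by apply: measurable_funTS; apply/measurable_EFinP.
  by move=> x _; rewrite lee_fin.
apply: is_cvg_nneseries => n _ _; apply: integral_ge0 => x _.
by rewrite lee_fin.
Qed.

HB.instance Definition _ := isMeasure.Build _ _ _ nu
  nu0 nu_ge0 nu_sigma_additive.

Let integral_mdensity_nnsfun (h : {nnsfun X >-> R}) :
  \int[nu]_x (h x)%:E = \int[mu]_x ((h x)%:E * (f x)%:E).
Proof.
have mEf : measurable_fun [set: X] (EFin \o f) by exact/measurable_EFinP.
have mh r : measurable (h @^-1` [set r]) by [].
under [LHS]eq_integral do rewrite fimfunE -fsumEFin//.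
rewrite [LHS]ge0_integral_fsum//; last 2 first.
  - by move=> r; exact/measurable_EFinP/measurableT_comp.
  - by move=> n x _; rewrite EFinM nnfun_muleindic_ge0.
under [RHS]eq_integral.
  move=> x _; rewrite fimfunE -fsumEFin// ge0_mule_fsuml; last first.
    by move=> r; rewrite EFinM nnfun_muleindic_ge0.
  over.
rewrite [RHS]ge0_integral_fsum//; last 2 first.
  - move=> r; apply: emeasurable_funM => //.
    by apply/measurable_EFinP; apply: measurable_funM.
  - move=> r x _; apply: mule_ge0; last by rewrite lee_fin.
    by rewrite EFinM nnfun_muleindic_ge0.
apply: eq_fsbigr => r _.
rewrite integralZl_indic_nnsfun// integral_indic// setIT.
have [r0|r0] := leP 0%R r; last first.
  rewrite preimage_nnfun0// measure0 mule0.
  by rewrite integral0_eq// => x _; rewrite indicE in_set0 mulr0 mul0e.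
transitivity (\int[mu]_x (r%:E * ((EFin \o f) \_ (h @^-1` [set r])) x)).
  rewrite ge0_integralZl//.
  - by rewrite -integral_mkcond.
  - apply/(measurable_restrictT (EFin \o f) (mh r)); exact: measurable_funTS.
  - by move=> x _; apply: erestrict_ge0 => y _; rewrite lee_fin.
apply: eq_integral => x _; rewrite indicE patchE.
by case: ifPn => _; rewrite ?mulr1// mulr0 mule0 mul0e.
Qed.

Lemma integral_mdensity (g : X -> \bar R) : measurable_fun [set: X] g ->
  (forall x, 0 <= g x) -> \int[nu]_x g x = \int[mu]_x (g x * (f x)%:E).
Proof.
move=> mg g0; pose g_ := nnsfun_approx measurableT mg.
have g_g x : (g_ n x)%:E @[n --> \oo] --> g x by exact: cvg_nnsfun_approx.
transitivity (limn (fun n => \int[nu]_x (g_ n x)%:E)).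
  rewrite -monotone_convergence//=.
  - by apply: eq_integral => x _; apply/esym/cvg_lim.
  - by move=> n; exact/measurable_EFinP.
  - by move=> n x _; rewrite lee_fin.
  - by move=> x _ a b ab; rewrite lee_fin//; exact/lefP/nd_nnsfun_approx.
transitivity (limn (fun n => \int[mu]_x ((g_ n x)%:E * (f x)%:E))).
  by congr (limn _); apply/funext => n; exact: integral_mdensity_nnsfun.
rewrite -monotone_convergence//=.
- apply: eq_integral => x _; apply/cvg_lim => //.
  by apply: cvgeZr => //; exact: g_g.
- by move=> n; apply: emeasurable_funM => //; exact/measurable_EFinP.
- by move=> n x _; apply: mule_ge0 => //; rewrite lee_fin.
- move=> x _ a b ab; apply: lee_wpmul2r; rewrite lee_fin//.
  exact/lefP/nd_nnsfun_approx.
Qed.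

End density.

End integral_lemmas.

(** * Borel sets of a locally compact second countable space *)

Section borel_topology.
Context {T : ptopologicalType} {R : realType}.
Implicit Types (mu sigma : {measure set (borel T) -> \bar R}) (U K : set T).

Lemma borel_open U : open U -> measurable (U : set (borel T)).
Proof. exact: sub_sigma_algebra. Qed.

Lemma borel_closed K : closed K -> measurable (K : set (borel T)).
Proof.
move=> cK; rewrite -[K]setCK; apply: measurableC; apply: borel_open.
exact: closed_openC.
Qed.

Lemma borel_compact K : hausdorff_space T -> compact K ->
  measurable (K : set (borel T)).
Proof. by move=> hT cK; apply: borel_closed; exact: compact_closed. Qed.

Lemma lsc_measurable (f : T -> \bar R) : lower_semicontinuous f ->
  measurable_fun [set: borel T] (f : borel T -> \bar R).
Proof.
move=> /lower_semicontinuousP lf.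
apply: (measurability _ (ErealGenOInfty.measurableE R)).
move=> /= _ [_ [a ->]] <-; rewrite setTI preimage_itvoy;
  exact: borel_open (lf a).
Qed.

Lemma compact_cover_seq K (U : T -> set T) : compact K ->
  (forall x, K x -> open (U x) /\ U x x) ->
  exists s : seq T, (forall x, x \in s -> K x) /\
    forall y, K y -> exists2 x, x \in s & U x y.
Proof.
rewrite compact_cover => + Uo => /(_ T K U) [x Kx|x Kx|D DK KD].
- by have [] := Uo x Kx.
- by exists x => //; have [] := Uo x Kx.
- exists (finmap.enum_fset D); split=> [x xD|y /KD[x xD Uxy]].
  + by have := DK x xD; rewrite inE.
  + by exists x.
Qed.

Lemma compact_finite_measure mu K : hausdorff_space T -> locally_finite mu ->
  compact K -> mu K < +oo.
Proof.
move=> hT lf cK; have [U Uo] := choice (lf : forall x, exists U, _).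
have [x Kx|s [_ KU]] := compact_cover_seq (U := U) cK.
  by have [] := Uo x.
have mU x : measurable (U x : set (borel T)).
  by apply: borel_open; have [] := Uo x.
have KsU : K `<=` \big[setU/set0]_(x <- s) U x.
  by move=> y /KU[x xs Uxy]; rewrite -bigcup_seq; exists x.
have : mu (\big[setU/set0]_(x <- s) U x) < +oo.
  elim: s {KU KsU} => [|x s ih]; first by rewrite big_nil measure0.
  rewrite big_cons; apply: le_lt_trans (measureU2 _ _ _) _ => //.
    exact: bigsetU_measurable.
  by apply: lte_add_pinfty => //; have [] := Uo x.
apply: le_lt_trans; apply: le_measure; rewrite ?inE//.
  exact: borel_compact.
exact: bigsetU_measurable.
Qed.

Hypothesis scT : @second_countable T.

Lemma second_countable_basis : exists B : nat -> set T,
  (forall n, open (B n)) /\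
  forall x V, nbhs x V -> exists2 n, B n x & B n `<=` V.
Proof.
case: scT => B cB [oB bB].
have [B0|[f]] := pfcard_geP cB.
  have [V [/= + _] _] := bB point setT (@filterT _ (nbhs (point : T)) _).
  by rewrite B0.
exists (fun n => f n); split=> [n|x V /bB[W [/= BW Wx] WV]].
  by apply: oB; exact: funS.
have [n _ fn] := @surj _ _ _ _ f _ BW.
by exists n; rewrite fn.
Qed.

(** This ties the product topology to the product of the Borel sigma-algebras: by second
    countability [W] is a countable union of rectangles of basic open sets. *)
Lemma open_prod_measurable (W : set (T * T)) : open W ->
  measurable (W : set (borel T * borel T)).
Proof.
move=> oW; have [B [oB bB]] := second_countable_basis.
have -> : W = \bigcup_n \bigcup_(m in [set m | B n `*` B m `<=` W])
    (B n `*` B m).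
  apply/seteqP; split=> [[x y] Wxy|z [n _ [m /= + nm]]]; last exact.
  have /= : nbhs (x, y) W by exact: open_nbhs_nbhs.
  move=> [[P Q] /= [/bB[n nx nP] /bB[m my mQ]] PQ].
  exists n => //; exists m => //=; apply: subset_trans PQ => -[u v] /= [Bu Bv].
  by split; [exact: nP|exact: mQ].
apply: bigcupT_measurable => n; apply: bigcup_measurable => m _.
by apply: measurableX; exact: borel_open.
Qed.

Lemma lsc_prod_measurable (g : T -> T -> \bar R) :
  lower_semicontinuous (fun z : T * T => g z.1 z.2) ->
  measurable_fun [set: borel T * borel T] (fun z => g z.1 z.2).
Proof.
move=> /lower_semicontinuousP lf.
apply: (measurability _ (ErealGenOInfty.measurableE R)).
move=> /= _ [_ [a ->]] <-; rewrite setTI preimage_itvoy.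
exact: open_prod_measurable (lf a).
Qed.

Hypotheses (lcT : locally_compact [set: T]) (hT : hausdorff_space T).

Lemma open_compact_exhaustion U : open U -> exists K : nat -> set T,
  [/\ forall n, compact (K n), nondecreasing_seq K & U = \bigcup_n K n].
Proof.
move=> oU; have [B [oB bB]] := second_countable_basis.
(* Keep the basic closures that are compact and lie in [U]; local compactness and regularity of
   compact Hausdorff neighbourhoods put every point of [U] in one of them. *)
pose C n := if `[< compact (closure (B n)) /\ closure (B n) `<=` U >]
  then closure (B n) else set0.
exists (fun n => \big[setU/set0]_(i < n.+1) C i); split.
- move=> n; apply: bigsetU_compact => i _; rewrite /C.
  by case: asboolP => [[]//|_]; exact: compact0.
- by move=> n m nm; apply/subsetPset; apply: subset_bigsetU.
- rewrite bigcup_bigsetU_bigcup; apply/seteqP; split=> [x Ux|x [n _]];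
    last first.
  by rewrite /C; case: asboolP => // -[_]; exact.
  have [V VT [cV clV]] := lcT (I : [set: T] x).
  have Vx : nbhs x V by apply: (@filterS _ (nbhs x) _ _ _ _ VT) => y; apply.
  have [W Wx WU] : filter_from (nbhs x) closure U.
    by apply: (compact_regular hT cV Vx); exact: open_nbhs_nbhs.
  have [n nx nWV] := bB x (W `&` V) (filterI Wx Vx).
  exists n => //; rewrite /C asboolT; first exact: subset_closure.
  split; last by apply: subset_trans WU; apply: closureS => y /nWV[].
  apply: (subclosed_compact _ cV); first exact: closed_closure.
  have /closure_id -> := clV.
  by apply: closureS => y /nWV[].
Qed.

(** Inner regularity, by exhausting [U] with compact sets. Bounds on superlevel sets of lower
    semicontinuous potentials are reduced in this way to compact sets, whose measure is finite. *)
Lemma measure_open_le mu U (M : \bar R) : open U ->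
  (forall K, compact K -> K `<=` U -> mu K <= M) -> mu U <= M.
Proof.
move=> oU KM; have [K [cK ndK UK]] := open_compact_exhaustion oU.
have mK n : measurable (K n : set (borel T)) by exact: borel_compact.
have : mu (K n) @[n --> \oo] --> mu U.
  by rewrite UK; apply: nondecreasing_cvg_mu => //; rewrite -UK;
    exact: borel_open.
move=> /cvg_lim <-//; apply: lime_le.
  apply: ereal_nondecreasing_is_cvgn => m n mn; apply: le_measure;
    rewrite ?inE//.
  by apply/subsetPset/ndK.
apply: nearW => n; apply: KM => //; rewrite UK; exact: bigcup_sup.
Qed.

Lemma locally_finite_sigma_finite mu : locally_finite mu ->
  sigma_finite [set: borel T] mu.
Proof.
move=> lf; have [K [cK _ TK]] := open_compact_exhaustion openT.
exists K => // n; split; first exact: borel_compact.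
exact: compact_finite_measure.
Qed.

End borel_topology.

(** * Lower semicontinuous kernels *)

Section tonelli_on_sets.
Context d1 d2 (X : measurableType d1) (Y : measurableType d2) (R : realType).
Variables (mu : {measure set X -> \bar R}) (nu : {measure set Y -> \bar R}).
Variable g : X -> Y -> \bar R.
Hypotheses (g0 : forall x y, 0 <= g x y)
  (mg : measurable_fun [set: X * Y] (fun z => g z.1 z.2)).
Variables (A : set X) (B : set Y).
Hypotheses (mA : measurable A) (mB : measurable B).

Let gAB z := g z.1 z.2 * (\1_A z.1 * \1_B z.2)%:E.

Let gAB0 z : 0 <= gAB z.
Proof. by rewrite mule_ge0// lee_fin mulr_ge0. Qed.

Let mgAB : measurable_fun [set: X * Y] gAB.
Proof.
apply: emeasurable_funM => //; apply/measurable_EFinP; apply: measurable_funM.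
- by apply: measurableT_comp => //; exact: measurable_indic.
- by apply: measurableT_comp => //; exact: measurable_indic.
Qed.

(** With [k] the indicator in the other variable, this peels the two indicators off [gAB] one at a
    time. *)
Let int_indic d (Z : measurableType d) (m : {measure set Z -> \bar R})
  (C : set Z) (f : Z -> \bar R) (k : R) : (0 <= k)%R -> measurable C ->
  measurable_fun [set: Z] f -> (forall z, 0 <= f z) ->
  \int[m]_z (f z * (k * \1_C z)%:E) = k%:E * \int[m]_(z in C) f z.
Proof.
move=> k0 mC mf f0; rewrite [in RHS]integral_mkcond -ge0_integralZl//.
- apply: eq_integral => z _; rewrite patchE indicE EFinM muleCA.
  by case: ifPn => _; rewrite ?mule1 ?mule0.
- by apply/(measurable_restrictT f) => //; exact: measurable_funTS.
- by move=> z _; exact: erestrict_ge0.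
Qed.

Let mg1 x : measurable_fun [set: Y] (g x).
Proof.
have -> : g x = (fun z => g z.1 z.2) \o (pair x) by [].
by apply: measurableT_comp.
Qed.

Let mg2 y : measurable_fun [set: X] (g^~ y).
Proof.
have -> : g^~ y = (fun z => g z.1 z.2) \o (fun x => (x, y)) by [].
by apply: measurableT_comp.
Qed.

Hypothesis nuS : sigma_finite [set: Y] nu.

Lemma measurable_fun_integral_set :
  measurable_fun [set: X] (fun x => \int[nu]_(y in B) g x y).
Proof.
(* The sigma-finiteness hypothesis is packed into the structure over which the Tonelli theorem is
   stated. *)
pose nu' : {sigma_finite_measure set Y -> \bar R} :=
  HB.pack (Measure.sort nu)
    (isSFinite.Build _ _ _ nu (sfinite_measure_sigma_finite nuS))
    (isSigmaFinite.Build _ _ _ nu nuS).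
pose gB z := g z.1 z.2 * (1 * \1_B z.2)%:E.
have := @measurable_fun_fubini_tonelli_F _ _ X Y R nu' gB.
rewrite (_ : fubini_F _ _ = fun x => \int[nu]_(y in B) g x y).
  apply.
  - apply: emeasurable_funM => //; apply/measurable_EFinP.
    apply: measurable_funM => //.
    by apply: measurableT_comp => //; exact: measurable_indic.
  - by move=> z; rewrite mule_ge0// lee_fin mulr_ge0.
apply/funext => x; rewrite /fubini_F /gB /=.
by rewrite int_indic// mul1e.
Qed.

Hypothesis muS : sigma_finite [set: X] mu.

Lemma tonelli_set : \int[mu]_(x in A) \int[nu]_(y in B) g x y =
  \int[nu]_(y in B) \int[mu]_(x in A) g x y.
Proof.
pose nu' : {sigma_finite_measure set Y -> \bar R} :=
  HB.pack (Measure.sort nu)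
    (isSFinite.Build _ _ _ nu (sfinite_measure_sigma_finite nuS))
    (isSigmaFinite.Build _ _ _ nu nuS).
pose mu' : {sigma_finite_measure set X -> \bar R} :=
  HB.pack (Measure.sort mu)
    (isSFinite.Build _ _ _ mu (sfinite_measure_sigma_finite muS))
    (isSigmaFinite.Build _ _ _ mu muS).
have := @fubini_tonelli _ _ X Y R mu' nu' gAB mgAB gAB0.
rewrite [X in X = _ -> _](_ : _ = \int[mu]_(x in A) \int[nu]_(y in B) g x y).
  rewrite [X in _ = X -> _](_ :
    _ = \int[nu]_(y in B) \int[mu]_(x in A) g x y)//.
  rewrite [RHS]integral_mkcond; apply: eq_integral => y _; rewrite /gAB/=.
  under eq_integral do rewrite mulrC.
  rewrite int_indic// patchE indicE.
  by case: ifPn => _; rewrite ?mul1e ?mul0e.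
rewrite [RHS]integral_mkcond; apply: eq_integral => x _; rewrite /gAB/=.
rewrite int_indic// patchE indicE.
by case: ifPn => _; rewrite ?mul1e ?mul0e.
Qed.

End tonelli_on_sets.

Lemma ereal_between (R : realType) (x y : \bar R) : 0 <= x -> x < y ->
  exists2 r : R, x < r%:E & r%:E < y.
Proof.
case: x => [x| |]//; case: y => [y| |]// x0 xy; last first.
  by exists (x + 1)%R; rewrite ?ltry// lte_fin ltrDl.
exists ((x + y) / 2)%R; rewrite !lte_fin in xy *.
  by rewrite midf_lt.
by rewrite midf_lt.
Qed.

Section lsc_kernels.
Context {T : ptopologicalType} {R : realType}.
Variable g : T -> T -> \bar R.
Hypothesis glsc : lower_semicontinuous (fun z : T * T => g z.1 z.2).

Lemma lsc_sectionl x : lower_semicontinuous (g x).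
Proof.
move=> y a /(glsc (x := (x, y)))[V [[P Q] /= [Px Qy] PQV] Va].
by exists Q => // z Qz; apply: (Va (x, z)); apply: PQV; split => //=;
  exact: nbhs_singleton.
Qed.

Lemma lsc_sectionr y : lower_semicontinuous (g^~ y).
Proof.
move=> x a /(glsc (x := (x, y)))[V [[P Q] /= [Px Qy] PQV] Va].
by exists P => // z Pz; apply: (Va (z, y)); apply: PQV; split => //=;
  exact: nbhs_singleton.
Qed.

Hypotheses (g0 : forall x y, 0 <= g x y) (scT : @second_countable T).

(* By Fatou's lemma, along a sequence converging to x. *)
Lemma lsc_potential (nu : {measure set (borel T) ->
  \bar R}) (D : set (borel T)) :
  measurable D -> lower_semicontinuous (fun x : T => \int[nu]_(y in D) g x y).
Proof.
move=> mD x a ax; apply: contrapT => noV.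
have [B [oB bB]] := second_countable_basis scT.
(* Basic sets missing [x] are replaced by the whole space, so that [V n] is a decreasing
   neighbourhood base at [x]. *)
pose C i := if `[< B i x >] then B i else setT.
pose V n := \big[setI/setT]_(i < n.+1) C i.
have nV n : nbhs x (V n).
  apply: (big_ind (nbhs x)) => [|P Q Px Qx|i _]; first exact: filterT.
    exact: filterI.
  rewrite /C; case: asboolP => [Bx|_]; last exact: filterT.
  by apply: open_nbhs_nbhs; split.
have /choice[z zV] : forall n, exists z,
  V n z /\ \int[nu]_(y in D) g z y <= a%:E.
  move=> n; apply: contrapT => noz; apply: noV; exists (V n) => //.
  by move=> y Vy; rewrite ltNge; apply/negP => ya; apply: noz; exists y.
have gz y : g x y <= limn_einf (fun n => g (z n) y).
  rewrite leNgt; apply/negP => /ereal_between[|r lr rg].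
    rewrite limn_einf_lim; apply: lime_ge; first exact: is_cvg_einfs.
    by apply: nearW => n; apply: le_ereal_inf_tmp => _ [m _ <-].
  have [W Wx Wr] := lsc_sectionr rg; have [n nx nW] := bB x W Wx.
  suff : r%:E <= limn_einf (fun n => g (z n) y) by rewrite leNgt lr.
  rewrite limn_einf_lim; apply: lime_ge; first exact: is_cvg_einfs.
  exists n => // m /= nm; apply: le_ereal_inf_tmp => _ [k /= mk <-].
  apply/ltW/Wr/nW; have [+ _] := zV k.
  rewrite /V -bigcap_mkord => /(_ n); rewrite /C asboolT//; apply.
  by rewrite /= ltnS (leq_trans nm).
suff : \int[nu]_(y in D) g x y <= a%:E by rewrite leNgt ax.
apply: (@le_trans _ _ (\int[nu]_(y in D) limn_einf (fun n => g (z n) y))).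
  by apply: ge0_le_integralW.
apply: le_trans; first apply: fatou => //.
  by move=> n; apply: measurable_funTS; apply: lsc_measurable;
    exact: lsc_sectionl.
rewrite limn_einf_lim; apply: lime_le; first exact: is_cvg_einfs.
apply: nearW => n; have [_] := zV n; apply: le_trans.
by apply: ereal_inf_lbound; exists n => /=.
Qed.

End lsc_kernels.

(** * A capacity estimate for a single set of finite measure *)

Section capacity.
Context d (X : measurableType d) (R : realType).
Variables (sigma nu : {measure set X -> \bar R}).
Variable g : X -> X -> \bar R.
Hypotheses (g0 : forall x y, 0 <= g x y)
  (mg : measurable_fun [set: X * X] (fun z => g z.1 z.2)).
Hypotheses (sigmaS : sigma_finite [set: X] sigma)
  (nuS : sigma_finite [set: X] nu).

(* The potential of Q is at most twice its average on at least half of Q; that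
   half is the set on which the potential bound h is required. *)
Lemma weak_type_of_energy (Q : set X) (a c h t : R) :
  measurable Q -> sigma Q < +oo -> (0 < a)%R -> (0 < c)%R -> (0 <= h)%R ->
    (0 <= t)%R ->
  (forall x y, g x y <= a%:E * g y x) ->
  \int[sigma]_(x in Q) \int[sigma]_(y in Q) g x y <= c%:E * sigma Q ->
  (forall x, \int[sigma]_(y in
     [set y | Q y /\ \int[sigma]_(z in Q) g y z <= (2 * c)%:E]) g x y <=
       h%:E) ->
  (forall x, Q x -> t%:E <= \int[nu]_y g x y) ->
  t%:E * sigma Q <= (2 * a * h)%:E * nu [set: X].
Proof.
move=> mQ Qoo a0 c0 h0 t0 ga gQ; set F := [set y | _ /\ _] => gF tQ.
have mpot D : measurable D ->
    measurable_fun [set: X] (fun x => \int[sigma]_(y in D) g x y).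
  by move=> mD; exact: measurable_fun_integral_set.
have mF : measurable F.
  have -> : F = Q `&` (fun x => \int[sigma]_(y in Q) g x y) @^-1`
      [set z | z <= (2 * c)%:E].
    by [].
  by apply: emeasurable_fun_infty_c => //; exact/measurable_funTS/mpot.
have FQ : F `<=` Q by move=> x [].
(* Off [F] the potential of [Q] exceeds [2 * c], so by Markov's inequality at most half of the
   finite mass of [Q] lies there. *)
have sF : sigma Q <= 2%:E * sigma F.
  have mQF : measurable (Q `\` F) by exact: measurableD.
  have : (2 * c)%:E * sigma (Q `\` F) <= c%:E * sigma Q.
    apply: le_trans gQ; apply: markov_ge0 => //.
    - exact/measurable_funTS/mpot.
    - by move=> x _; exact: integral_ge0.
    - by rewrite mulr_ge0// ltW.
    - move=> x [Qx /= nFx]; rewrite leNgt; apply/negP => /ltW xF.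
      by apply: nFx; split.
  have QE : sigma Q = sigma F + sigma (Q `\` F).
    rewrite -measureU//; first by rewrite setDUK.
    by apply/seteqP; split=> x // -[? []].
  have Foo : sigma F \is a fin_num.
    by rewrite ge0_fin_numE//; apply: le_lt_trans Qoo; exact: measureS.
  have QFoo : sigma (Q `\` F) \is a fin_num.
    by rewrite ge0_fin_numE//; apply: le_lt_trans Qoo; exact: measureS.
  rewrite QE -(fineK Foo) -(fineK QFoo) -!EFinD -!EFinM !lee_fin.
  have -> : (2 * c * fine (sigma (Q `\` F)) = c * (2 *
    fine (sigma (Q `\` F))))%R.
    by rewrite mulrCA mulrA.
  rewrite ler_pM2l//; lra.
(* Integrate the potential of [nu] over [F], exchange the integrals, and swap the arguments of [g]
   at the cost of [a] to meet the bound on the potential of [F]. *)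
have tF : t%:E * sigma F <= (a * h)%:E * nu [set: X].
  apply: (@le_trans _ _ (\int[sigma]_(x in F) \int[nu]_y g x y)).
    apply: markov_ge0 => //.
    - by apply: measurable_funTS; exact: measurable_fun_integral_set.
    - by move=> x _; exact: integral_ge0.
    - by move=> x /FQ; exact: tQ.
  rewrite tonelli_set// -integral_cst//; apply: ge0_le_integralW => y _.
    by apply: integral_ge0 => x _.
  apply: (@le_trans _ _ (\int[sigma]_(x in F) (a%:E * g y x))).
    exact: ge0_le_integralW.
  rewrite ge0_integralZl//; last 2 first.
  - have -> : g y = (fun z => g z.1 z.2) \o (pair y) by [].
    by apply: measurable_funTS; apply: measurableT_comp.
  - by rewrite lee_fin ltW.
  by rewrite EFinM lee_wpmul2l// lee_fin ltW.
apply: (@le_trans _ _ (2%:E * (t%:E * sigma F))).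
  by rewrite muleCA lee_wpmul2l// lee_fin.
by rewrite -mulrA EFinM -muleA lee_wpmul2l// lee_fin.
Qed.

End capacity.

(** * Energy, weak type and strong type *)

Section energy_to_weak_type.
Context {T : ptopologicalType} {R : realType}.
Variable sigma : {measure set (borel T) -> \bar R}.
Variable G : T -> T -> \bar R.
Hypotheses (lcT : locally_compact [set: T]) (hT : hausdorff_space T)
  (scT : @second_countable T) (sigma_lf : locally_finite sigma)
  (G0 : forall x y : T, 0 <= G x y)
  (Glsc : lower_semicontinuous (fun z : T * T => G z.1 z.2)).

Let GxE (x : T) : measurable_fun [set: borel T] (G x : borel T -> \bar R).
Proof. by apply: lsc_measurable; exact: lsc_sectionl. Qed.

Lemma finite_mdensity_locally_finite (f : borel T -> R)
    (f0 : forall x, (0 <= f x)%R) (mf : measurable_fun [set: borel T] f) :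
  \int[sigma]_x (f x)%:E < +oo -> locally_finite (mdensity sigma f0 mf).
Proof. by move=> foo x; exists setT; split => //; exact: openT. Qed.

(* F only has to be a closed set carrying the measure, so that its support never
   has to be computed. *)
Lemma max_principle_density (h M : R) (f : borel T -> R) (F : set T) :
  weak_maximum_principle G h -> (0 < M)%R -> (forall x, (0 <= f x)%R) ->
  measurable_fun [set: borel T] f -> \int[sigma]_x (f x)%:E < +oo ->
  closed F -> (forall x, ~ F x -> f x = 0%R) ->
  (forall x, F x -> \int[sigma]_y (G x y * (f y)%:E) <= M%:E) ->
  forall x, \int[sigma]_y (G x y * (f y)%:E) <= (h * M)%:E.
Proof.
move=> wmp M0 f0 mf foo cF fF FM x.
have Gf y : potential G (mdensity sigma f0 mf) y =
    \int[sigma]_z (G y z * (f z)%:E).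
  by rewrite /potential integral_mdensity.
rewrite -Gf; apply: wmp => //; first exact: finite_mdensity_locally_finite.
move=> y sy; rewrite Gf; apply: FM; apply: contrapT => nFy.
have := sy (~` F) (closed_openC cF) nFy; rewrite /= /mdensity.
by rewrite integral0_eq ?ltxx// => z /fF ->.
Qed.

Lemma energy_bound_weak_type (h : R) : quasi_symmetric G ->
  (1 <= h)%R -> weak_maximum_principle G h ->
  energy_bound_on_compacts G sigma -> weak_type_bound G sigma.
Proof.
move=> [a a0 qs] h1 wmp [c c0 cE].
have h0 : (0 < h)%R by exact: lt_le_trans h1.
have ac0 : (0 < a * c)%R by rewrite mulr_gt0.
have sfin mu : locally_finite mu -> sigma_finite [set: borel T] mu.
  exact: locally_finite_sigma_finite.
have mG : measurable_fun [set: borel T * borel T] (fun z => G z.1 z.2).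
  exact: lsc_prod_measurable.
(* Swapping the arguments of [G] turns the energy constant into [a * c]; the potential is then at
   most [2 * (a * c)] on the good half, and [h] times that everywhere. *)
exists (2 * a * (h * (2 * (a * c))))%R; first by rewrite !mulr_gt0.
move=> nu nu_lf; apply: ge_ereal_sup => _ [t t0 <-].
have -> : [set x | t%:E < `|potential G nu x|] =
    [set x : T | t%:E < \int[nu]_y G x y].
  apply/seteqP; split=> x /=; rewrite gee0_abs//; exact: integral_ge0.
rewrite -lee_pdivlMl//; apply: measure_open_le => //.
  exact: (lower_semicontinuousP _).1 (lsc_potential Glsc G0 scT measurableT) t.
move=> K cK KU; rewrite lee_pdivlMl//.
have mK : measurable (K : set (borel T)) by exact: borel_compact.
have Koo : sigma K < +oo by exact: compact_finite_measure.
apply: (@weak_type_of_energy _ _ _ sigma nu G _ _ _ _ _ a (a * c)) => //.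
- exact: sfin.
- exact: sfin.
- by rewrite ltW// mulr_gt0// mulr_gt0.
- exact: ltW.
- by move=> x y; have [] := qs x y.
- rewrite [(a * c)%:E]EFinM -muleA;
    apply: (@le_trans _ _ (a%:E * energy G sigma K)).
    rewrite /energy -ge0_integralZl//; last 3 first.
    + apply: measurable_funTS.
      apply: (@measurable_fun_integral_set _ _ (borel T) (borel T) R sigma (fun
        x y => G y x)) => //.
      * exact: (measurableT_comp mG (@measurable_swap _ _ (borel T) (borel T))).
      * exact: sfin.
    + by move=> x _; exact: integral_ge0.
    + by rewrite lee_fin ltW.
    apply: ge0_le_integralW => x _; first exact: integral_ge0.
    rewrite -ge0_integralZl//; last 2 first.
    + by apply: measurable_funTS; apply: lsc_measurable; exact: lsc_sectionr.
    + by rewrite lee_fin ltW.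
    by apply: ge0_le_integralW => // y _; have [] := qs x y.
  by apply: lee_wpmul2l; [rewrite lee_fin ltW|exact: cE].
- set F := [set y | _ /\ _] => x.
  (* A sublevel set of a lower semicontinuous potential is closed; this lets [F] take the place of
     the support in the maximum principle. *)
  have cF : closed (F : set T).
    have -> : F = K `&` ~` [set y :
      T | (2 * (a * c))%:E < \int[sigma]_(z in K) G y z].
      apply/seteqP; split=> y [Ky Fy]; split => //=.
        by rewrite /= in Fy; apply/negP; rewrite -leNgt.
      by rewrite leNgt; apply/negP.
    apply: closedI; first exact: compact_closed.
    apply: open_closedC.
    exact: (lower_semicontinuousP _).1 (lsc_potential Glsc G0 scT mK) _.
  have mF : measurable (F : set (borel T)) by exact: borel_closed.
  have FK : F `<=` K by move=> y [].
  have intF y : \int[sigma]_(z in F) G y z =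
      \int[sigma]_z (G y z * (\1_F z)%:E).
    rewrite integral_mkcond; apply: eq_integral => z _.
    by rewrite patchE indicE; case: ifPn => _; rewrite ?mule1 ?mule0.
  rewrite intF; apply: (max_principle_density (F := F)) => //.
  + by rewrite mulr_gt0.
  + rewrite integral_indic// setIT; apply: le_lt_trans Koo; exact: measureS.
  + by move=> y Fy; rewrite indicE memNset.
  + move=> y [Ky Fy]; apply: le_trans Fy; rewrite -intF.
    by apply: ge0_subset_integral => //; exact: measurable_funTS.
- by move=> x /KU /ltW.
Qed.

(** Apply the case [p = 2] to the indicator of [A]. The bound holds for all measurable sets of
    finite measure, so that it serves for balls as well as for compact sets. *)
Lemma strong_type_energy_bound : quasi_symmetric G ->
  strong_type_bound G sigma ->
  exists2 c : R, (0 < c)%R & forall A : set (borel T), measurable A ->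
    sigma A < +oo -> energy G sigma A <= c%:E * sigma A.
Proof.
move=> [a a0 qs] /(_ 2%R)[|c c0 cN]; first by rewrite ltr1n.
exists (a * (c ^+ 2 + 1))%R; first by rewrite mulr_gt0// ltr_wpDl// sqr_ge0.
move=> A mA Aoo.
have sfin := locally_finite_sigma_finite scT lcT hT sigma_lf.
have mG : measurable_fun [set: borel T * borel T] (fun z => G z.1 z.2).
  exact: lsc_prod_measurable.
have intA y : potential_density G sigma \1_A y = \int[sigma]_(z in A) G y z.
  rewrite /potential_density [RHS]integral_mkcond; apply: eq_integral => z _.
  by rewrite patchE indicE; case: ifPn => _; rewrite ?mule1 ?mule0.
pose w y := \int[sigma]_(z in A) G y z.
have w0 y : 0 <= w y by exact: integral_ge0.
have mw : measurable_fun [set: borel T] w by exact: measurable_fun_integral_set.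
have n20 : (2%R : R) != 0%R by rewrite pnatr_eq0.
have SA : \int[sigma]_x `|(EFin \o \1_A) x| `^ 2 = sigma A.
  rewrite -[in RHS](setIT A) -integral_indic//; apply: eq_integral => x _ /=.
  rewrite indicE; case: (_ \in _).
    by rewrite normr1 powR1.
  by rewrite normr0 powR0.
have LA : (\1_A : borel T -> R) \in Lfun sigma 2%:E.
  rewrite inE; apply/andP; split; rewrite inE; first exact: measurable_indic.
  by apply: (lty_poweRy n20); rewrite powR_Lnorm// SA.
have w2 : \int[sigma]_x `|w x| `^ 2 <= (c ^+ 2)%:E * sigma A.
  rewrite -SA -!powR_Lnorm//.
  have -> : (c ^+ 2)%:E = c%:E `^ 2 by rewrite poweR_EFin powR_mulrn// ltW.
  rewrite -poweRM ?Lnorm_ge0//; last by rewrite lee_fin ltW.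
  apply: gt0_ler_poweR => //.
  - by rewrite in_itv/= leey andbT Lnorm_ge0.
  - by rewrite in_itv/= leey andbT mule_ge0 ?Lnorm_ge0// lee_fin ltW.
  have -> : w = potential_density G sigma \1_A by apply/funext => y;
    rewrite intA.
  exact: cN.
apply: (@le_trans _ _ (a%:E * \int[sigma]_(y in A) w y)).
  rewrite /energy -ge0_integralZl//; last 2 first.
  + exact: measurable_funTS.
  + by rewrite lee_fin ltW.
  apply: ge0_le_integralW => x _; first exact: integral_ge0.
  rewrite -ge0_integralZl//; last 2 first.
  + exact: measurable_funTS.
  + by rewrite lee_fin ltW.
  by apply: ge0_le_integralW => // y _; have [] := qs y x.
rewrite EFinM -muleA; apply: lee_wpmul2l; first by rewrite lee_fin ltW.
have mw2 : measurable_fun [set: borel T] (fun y => `|w y| `^ 2).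
  apply: (measurableT_comp (measurable_poweR 2)); exact: measurableT_comp.
(* The inequality [w <= w ^ 2 + 1] stands in for Cauchy-Schwarz and accounts for the constant
   [c ^+ 2 + 1]. *)
apply: (@le_trans _ _ (\int[sigma]_(y in A) (`|w y| `^ 2 + 1))).
  apply: ge0_le_integralW => // y _; rewrite gee0_abs//.
  have := w0 y; case: (w y) => [r r0| |]//.
  + rewrite poweR_EFin powR_mulrn// -EFinD lee_fin.
    have := sqr_ge0 (r - 1); nra.
  + by rewrite poweRyr// addye.
rewrite ge0_integralD//; last 2 first.
- by move=> y _; exact: poweR_ge0.
- exact: measurable_funTS.
rewrite integral_cst// mul1e EFinD ge0_muleDl ?lee_fin ?sqr_ge0// mul1e
  leeD2r//.
apply: le_trans w2; apply: ge0_subset_integral => // y _; exact: poweR_ge0.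
Qed.

End energy_to_weak_type.

(** * Summation of good-lambda inequalities over levels *)

Section geometric_levels.
Context {R : realType}.
Implicit Types (b q p : R) (w lam : nat -> R).

Lemma geometric_sum_le (beta : R) w n : (1 < beta)%R -> (0 <= w 0%N)%R ->
  (forall k, w k.+1 = beta * w k)%R ->
  (\sum_(k < n) w k <= w n / (beta - 1))%R.
Proof.
move=> b1 w0 wS; elim: n => [|n ih].
  by rewrite big_ord0 divr_ge0// subr_ge0 ltW.
rewrite big_ord_recr/= (le_trans (lerD ih (lexx _)))// wS.
rewrite le_eqVlt; apply/orP; left; apply/eqP.
by field; rewrite subr_eq0 gt_eqF.
Qed.

(** When the last level is below [S], the whole sum is at most a geometric sum governed by that
    level; otherwise the last level adds nothing. *)
Lemma geometric_truncated_sum_le (beta S q : R) lam n : (1 < beta)%R ->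
  (0 < q)%R -> (0 <= S)%R -> (forall k, 0 < lam k)%R ->
  (forall k, lam k.+1 `^ q = beta * lam k `^ q)%R ->
  (\sum_(k < n) (if lam k < S then lam k `^ q else 0)
    <= beta / (beta - 1) * S `^ q)%R.
Proof.
move=> b1 q0 S0 l0 lS; elim: n => [|n ih].
  by rewrite big_ord0 mulr_ge0 ?powR_ge0// divr_ge0 ?subr_ge0// ltW// (lt_trans
    ltr01).
rewrite big_ord_recr/=; case: ifPn => [lnS|_]; last by rewrite addr0.
apply: (@le_trans _ _ (\sum_(k < n.+1) lam k `^ q)%R).
  rewrite big_ord_recr/= lerD2r; apply: ler_sum => k _.
  by case: ifP => // _; exact: powR_ge0.
apply: (le_trans (@geometric_sum_le beta (fun k => lam k `^ q)%R n.+1 b1 _ lS)).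
  exact: powR_ge0.
rewrite lS mulrAC ler_wpM2l//.
  by rewrite divr_ge0 ?subr_ge0// ltW// (lt_trans ltr01).
by apply: ge0_ler_powR; rewrite ?nnegrE//; exact: ltW.
Qed.

(** The value of [eta] makes the terms with [s k] on the right add up to half of the sum on the
    left. Only finitely many real terms occur, so that half can be subtracted. *)
Lemma absorb_levels (B c eta I : R) (lam w s psi : nat -> R) n :
  (0 < B)%R -> (0 < c)%R -> eta = ((2 * B * c)^-1)%R ->
  (forall k, 0 <= lam k)%R -> (forall k, 0 <= w k)%R ->
    (forall k, 0 <= s k)%R ->
  (forall k, lam k.+1 * w k.+1 = B * (lam k * w k))%R ->
  (lam 0%N * s 0%N <= c * I)%R ->
  (forall k, lam k * s k.+1 <= c * (eta * lam k * s k + psi k))%R ->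
  (\sum_(k < n.+1) lam k * w k * s k <=
    2 * (w 0%N * c * I + B * c * \sum_(k < n) w k * psi k))%R.
Proof.
move=> B0 c0 etaE l0 w0 s0 lw W GL.
pose X m := (\sum_(k < m) lam k * w k * s k)%R.
have XS : (X n <= X n.+1)%R.
  by rewrite /X big_ord_recr/= lerDl !mulr_ge0.
have : (X n.+1 <= w 0%N * c * I + 2^-1 * X n +
  B * c * \sum_(k < n) w k * psi k)%R.
  rewrite /X big_ord_recl/= -addrA; apply: lerD.
    rewrite (_ : lam 0%N * w 0%N * s 0%N = w 0%N * (lam 0%N * s 0%N))%R;
      last by ring.
    by rewrite -mulrA ler_wpM2l.
  rewrite !mulr_sumr -big_split/=; apply: ler_sum => k _.
  rewrite /bump/= add1n lw.
  have -> : (B * (lam k * w k) * s k.+1 = B * w k * (lam k * s k.+1))%R by ring.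
  apply: le_trans (ler_wpM2l _ (GL k)) _; first by rewrite mulr_ge0// ltW.
  rewrite le_eqVlt; apply/orP; left; apply/eqP; rewrite etaE; field.
  by rewrite !gt_eqF.
rewrite -/(X n.+1); lra.
Qed.

Lemma level_below (b S : R) (N : nat) : (1 < b)%R -> (b ^- N < S)%R ->
  (S <= b ^+ N)%R -> exists2 k : nat, (k < (N + N).+1)%N &
  (b ^- N * b ^+ k < S <= b * (b ^- N * b ^+ k))%R.
Proof.
move=> b1 NS SN; have b0 : (0 < b)%R by exact: lt_trans b1.
pose P k := (S <= b ^- N * b ^+ k)%R.
have exP : exists k, P k.
  exists (N + N)%N; rewrite /P exprD mulrA mulVf ?mul1r//.
  by rewrite expf_neq0// gt_eqF.
case: (ex_minnP exP) => -[|k] Pk kmin.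
  by move: Pk; rewrite /P expr0 mulr1 leNgt NS.
exists k.
  suff : (k.+1 <= N + N)%N by move=> /leqW.
  apply: kmin; rewrite /P exprD mulrA mulVf ?mul1r//.
  by rewrite expf_neq0// gt_eqF.
rewrite mulrCA -exprS -/(P k.+1) Pk andbT ltNge; apply/negP => /kmin.
by rewrite ltnn.
Qed.

Lemma lt_poweR_root (p r : R) (x : \bar R) : (0 < p)%R -> (0 <= r)%R ->
  0 <= x -> r%:E < x `^ p -> (r `^ p^-1)%:E < x.
Proof.
move=> p0 r0 x0; apply: contra_ltT; rewrite -leNgt => xr.
have := @gt0_ler_poweR R p (ltW p0) x (r `^ p^-1)%:E.
rewrite !in_itv/= !leey !andbT lee_fin powR_ge0 => /(_ x0 isT xr).
by rewrite -powRrM mulVf ?gt_eqF// powRr1// leNgt.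
Qed.

End geometric_levels.

Section marcinkiewicz.
Context d (X : measurableType d) (R : realType).
Variable mu : {measure set X -> \bar R}.

Lemma limn_einf_le_near (v : nat -> \bar R) (M : \bar R) :
  (\forall n \near \oo, v n <= M) -> limn_einf v <= M.
Proof.
move=> [n _ vM]; rewrite limn_einf_lim; apply: lime_le;
  first exact: is_cvg_einfs.
apply: nearW => m; apply: (@le_trans _ _ (v (maxn m n))).
  by apply: ereal_inf_lbound; exists (maxn m n) => //=; exact: leq_maxl.
by apply: vM; rewrite /= leq_maxr.
Qed.

Lemma limn_einf_ge_near (v : nat -> \bar R) (M : \bar R) :
  (\forall n \near \oo, M <= v n) -> M <= limn_einf v.
Proof.
move=> [n _ vM]; rewrite limn_einf_lim; apply: lime_ge;
  first exact: is_cvg_einfs.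
exists n => // m /= nm; apply: le_ereal_inf_tmp => _ [k /= mk <-].
by apply: vM; rewrite /= (leq_trans nm).
Qed.

Variables (b c p : R).
Hypotheses (b1 : (1 < b)%R) (c0 : (0 < c)%R) (p1 : (1 < p)%R).
Variables (u : X -> \bar R) (f : X -> R).
Hypotheses (mu_u : measurable_fun [set: X] u) (u0 : forall x, 0 <= u x).
Hypotheses (mf : measurable_fun [set: X] f) (f0 : forall x, (0 <= f x)%R).
Hypothesis foo : \int[mu]_x (f x)%:E < +oo.
Hypothesis weak : forall t : R, (0 < t)%R ->
  t%:E * mu [set x | t%:E < u x] <= c%:E * \int[mu]_x (f x)%:E.
Hypothesis good : forall t : R, (0 < t)%R ->
  t%:E * mu [set x | (b * t)%:E < u x] <=
    c%:E * \int[mu]_(x in [set x | t%:E < u x]) (f x)%:E.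

Let level (t : R) : set X := [set x | t%:E < u x].
(** The weight of level [t] is its power [q], [eta] is the value that [absorb_levels] requires for
    the ratio b to the power p, and [Cq] comes from summing the levels below [f x / eta]. *)
Let q := (p - 1)%R.
Let eta := ((2 * b `^ p * c)^-1)%R.
Let Cq := (b `^ q / (b `^ q - 1) * eta^-1 `^ q)%R.

Let b0 : (0 < b)%R. Proof. exact: lt_trans b1. Qed.
Let q0 : (0 < q)%R. Proof. by rewrite subr_gt0. Qed.
Let p0 : (0 < p)%R. Proof. exact: lt_trans p1. Qed.
Let eta0 : (0 < eta)%R. Proof. by rewrite invr_gt0 !mulr_gt0// powR_gt0. Qed.

Let bq1 : (1 < b `^ q)%R.
Proof.
have := @gt0_ltr_powR R q q0 1%R b.
by rewrite powR1 !nnegrE ler01 (ltW b0) => /(_ isT isT b1).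
Qed.

Let mE (t : R) : measurable [set x | t%:E < u x].
Proof.
by rewrite -[X in measurable X]setTI; exact: emeasurable_fun_o_infty.
Qed.

Let mEf (t : R) : measurable [set x | (t < f x)%R].
Proof.
rewrite (_ : [set x | _] = [set: X] `&` [set x | t%:E < (EFin \o f) x]).
  by apply: emeasurable_fun_o_infty => //; exact/measurable_EFinP.
by rewrite setTI; apply/seteqP; split => x /=; rewrite lte_fin.
Qed.

Let finint (A : set X) : measurable A ->
  \int[mu]_(x in A) (f x)%:E \is a fin_num.
Proof.
move=> mA; rewrite ge0_fin_numE; last by apply: integral_ge0 => x _;
  rewrite lee_fin.
apply: le_lt_trans foo; apply: ge0_subset_integral => //.
  exact/measurable_EFinP.
by move=> x _; rewrite lee_fin.
Qed.

Let finE (t : R) : (0 < t)%R -> mu [set x | t%:E < u x] \is a fin_num.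
Proof.
move=> t0; rewrite ge0_fin_numE//; have := weak t0.
rewrite -lee_pdivlMl// => /le_lt_trans; apply.
rewrite -(fineK (finint measurableT)) -!EFinM; exact: ltry.
Qed.

(** Where [f] is at most [eta * t] it is replaced by that constant, giving the term to be absorbed;
    the rest of [f] goes to the tail. *)
Let int_split (t : R) : (0 < t)%R ->
  \int[mu]_(x in [set x | t%:E < u x]) (f x)%:E <=
  (eta * t)%:E * mu [set x | t%:E < u x] +
  \int[mu]_(x in [set x | (eta * t < f x)%R]) (f x)%:E.
Proof.
move=> t0; set A := [set x | t%:E < u x]; set E := [set x | _].
have mE' : measurable E by exact: mEf.
have mA : measurable A by exact: mE.
pose g := (EFin \o f) \_ E.
have g0 x : 0 <= g x by apply: erestrict_ge0 => y _; rewrite lee_fin.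
have mg : measurable_fun [set: X] g.
  apply/(measurable_restrictT _ mE'); apply: measurable_funTS.
  exact/measurable_EFinP.
have et0 : (0 <= eta * t)%R by rewrite mulr_ge0 ?ltW.
rewrite -integral_cst//.
rewrite [X in _ + X]integral_mkcond -/g.
apply: (@le_trans _ _ (\int[mu]_(x in A) ((eta * t)%:E + g x))).
  apply: ge0_le_integralW => x Ax; first by rewrite lee_fin.
  rewrite /g patchE; case: ifPn => [_|/negP xE]; first by rewrite leeDr.
  rewrite adde0 lee_fin leNgt; apply/negP => fx; apply: xE.
  by rewrite inE.
rewrite ge0_integralD//; last exact: measurable_funTS.
by rewrite leeD2l//; apply: ge0_subset_integral.
Qed.

Section levels.
Variable N : nat.
Let lam k := (b ^- N * b ^+ k)%R.
Let w k := (lam k `^ q)%R.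

Let lam0 k : (0 < lam k)%R.
Proof. by rewrite mulr_gt0 ?invr_gt0 ?exprn_gt0. Qed.

Let lamS k : lam k.+1 = (b * lam k)%R.
Proof. by rewrite /lam exprS mulrCA. Qed.

Let wS k : w k.+1 = (b `^ q * w k)%R.
Proof. by rewrite /w lamS powRM// ltW. Qed.

Let powRp t : (0 <= t)%R -> (t `^ p = t * t `^ q)%R.
Proof.
move=> t0; rewrite -{2}(powRr1 t0) -powRD; first by rewrite addrC subrK.
by rewrite addrC subrK gt_eqF.
Qed.

(** Exchange sum and integral: at a point [x] only the levels below [f x / eta] count, and their
    weights form a truncated geometric sum of order [q]. The extra factor [f x] restores the
    exponent [p]. *)
Let tail_sum n :
  (\sum_(k < n) w k * fine (\int[mu]_(x in [set x | (eta *
    lam k < f x)%R]) (f x)%:E))%:E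
  <= Cq%:E * \int[mu]_x ((f x) `^ p)%:E.
Proof.
pose g k x : R := (f x * (if lam k < f x / eta then w k else 0))%R.
have g0 k x : (0 <= g k x)%R.
  by rewrite mulr_ge0//; case: ifP => // _; exact: powR_ge0.
have gE k x : ((g k x)%:E = (w k)%:E * ((EFin \o f) \_ [set x | (eta *
  lam k < f x)%R]) x).
  rewrite /g patchE ltr_pdivlMr// mulrC [(lam k * eta)%R]mulrC.
  case: ifPn => fx; first by rewrite mem_set.
  by rewrite memNset ?mul0r ?mule0//; exact/negP.
have mgE k : measurable_fun [set: X]
    ((EFin \o f) \_ [set x | (eta * lam k < f x)%R]).
  apply/(measurable_restrictT _ (mEf _)); apply: measurable_funTS.
  exact/measurable_EFinP.
rewrite -sumEFin.
rewrite (eq_bigr (fun k : 'I_n => \int[mu]_x (g k x)%:E)); last first.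
  move=> k _; rewrite EFinM fineK; last exact: finint.
  under [RHS]eq_integral do rewrite gE.
  rewrite ge0_integralZl//; first by rewrite [in LHS]integral_mkcond.
  - by move=> x _; apply: erestrict_ge0 => y _; rewrite lee_fin.
  - by rewrite lee_fin powR_ge0.
rewrite -ge0_integral_sum//; last 2 first.
- move=> k; under eq_fun do rewrite gE.
  exact: emeasurable_funM.
- by move=> k x _; rewrite lee_fin.
have mfp : measurable_fun [set: X] (fun x => (f x `^ p)%:E).
  by apply/measurable_EFinP; apply: (measurableT_comp (measurable_powR p)).
have Cq0 : (0 <= Cq)%R.
  by rewrite /Cq mulr_ge0 ?powR_ge0// divr_ge0 ?powR_ge0// subr_ge0 ltW.
rewrite -ge0_integralZl//; last first.
  by move=> x _; rewrite lee_fin powR_ge0.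
apply: ge0_le_integralW => x _.
  by apply: sume_ge0 => k _; rewrite lee_fin.
rewrite sumEFin -EFinM lee_fin /g -mulr_sumr.
have fe0 : (0 <= f x / eta)%R by rewrite divr_ge0// ltW.
apply: (@le_trans _ _ (f x * (b `^ q / (b `^ q - 1) * (f x / eta) `^ q))%R).
  by rewrite ler_wpM2l//; exact: geometric_truncated_sum_le.
rewrite powRM//; last by rewrite invr_ge0 ltW.
rewrite [(f x `^ p)%R]powRp// /Cq.
by rewrite le_eqVlt; apply/orP; left; apply/eqP; ring.
Qed.

Let level_sum :
  \sum_(k < (N + N).+1) ((lam k `^ p)%:E * mu [set x | (lam k)%:E < u x]) <=
  (2 * (b ^- N) `^ q * c)%:E * \int[mu]_x (f x)%:E +
  (2 * b `^ p * c * Cq)%:E * \int[mu]_x ((f x) `^ p)%:E.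
Proof.
pose s k := fine (mu [set x | (lam k)%:E < u x]).
pose I := fine (\int[mu]_x (f x)%:E).
pose psi k := fine (\int[mu]_(x in [set x | (eta * lam k < f x)%R]) (f x)%:E).
have sE k : mu [set x | (lam k)%:E < u x] = (s k)%:E by rewrite fineK// finE.
have IE : \int[mu]_x (f x)%:E = I%:E by rewrite fineK// finint.
have psiE k : \int[mu]_(x in [set x | (eta *
  lam k < f x)%R]) (f x)%:E = (psi k)%:E.
  by rewrite fineK// finint.
have bp0 : (0 < b `^ p)%R by exact: powR_gt0.
have := @absorb_levels R (b `^ p)%R c eta I lam w s psi (N + N)%N bp0 c0 erefl.
move=> /(_ (fun k => ltW (lam0 k)) (fun k => powR_ge0 _ _)).
move=> /(_ (fun k => fine_ge0 (measure_ge0 _ _))) H.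
apply: (@le_trans _ _ (2 * (w 0%N * c * I + b `^ p * c * \sum_(k < N +
  N) w k * psi k))%:E).
  rewrite (eq_bigr (fun k : 'I_(N + N).+1 => (lam k * w k * s k)%:E));
    last first.
    by move=> k _; rewrite sE -EFinM powRp// ltW.
  rewrite sumEFin lee_fin; apply: H.
  - by move=> k; rewrite wS lamS (powRp (ltW b0)); ring.
  - by have := weak (lam0 0%N); rewrite sE IE -!EFinM lee_fin.
  - move=> k.
    have : (lam k * s k.+1)%:E <=
      c%:E * ((eta * lam k)%:E * (s k)%:E + (psi k)%:E).
      rewrite EFinM -!sE -psiE lamS; apply: le_trans (good (lam0 k)) _.
      by apply: lee_wpmul2l; [rewrite lee_fin ltW|exact: int_split].
    by rewrite -[X in _ * (X + _)]EFinM -EFinD -EFinM lee_fin.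
rewrite IE mulrDr EFinD; apply: leeD.
  rewrite -EFinM lee_fin /w /lam expr0 mulr1 le_eqVlt; apply/orP; left;
    apply/eqP; ring.
rewrite [(2 * b `^ p * c * Cq)%:E]EFinM -muleA.
rewrite !mulrA EFinM; apply: lee_wpmul2l;
  first by rewrite lee_fin !mulr_ge0// ltW.
exact: tail_sum.
Qed.

Lemma integral_levels_le :
  \int[mu]_x ((b `^ p)%:E * \sum_(k < (N + N).+1)
     ((lam k `^ p)%:E * (\1_(level (lam k)) x : R)%:E)) <=
  (b `^ p)%:E * ((2 * (b ^- N) `^ q * c)%:E * \int[mu]_x (f x)%:E +
  (2 * b `^ p * c * Cq)%:E * \int[mu]_x ((f x) `^ p)%:E).
Proof.
have m1 k : measurable_fun [set: X] (fun x => (\1_(level (lam k)) x : R)%:E).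
  by apply/measurable_EFinP; apply: measurable_indic; exact: mE.
have l1 k x : 0 <= (lam k `^ p)%:E * (\1_(level (lam k)) x : R)%:E.
  by rewrite mule_ge0 ?lee_fin ?powR_ge0.
have ml1 k : measurable_fun [set: X] (fun x =>
  (lam k `^ p)%:E * (\1_(level (lam k)) x : R)%:E).
  exact: emeasurable_funM.
rewrite ge0_integralZl//; last 3 first.
- exact: emeasurable_sum.
- by move=> x _; exact: sume_ge0.
- by rewrite lee_fin powR_ge0.
apply: lee_wpmul2l; first by rewrite lee_fin powR_ge0.
apply: le_trans level_sum; rewrite ge0_integral_sum//.
apply: lee_sum => k _; rewrite ge0_integralZl//; last first.
  by rewrite lee_fin powR_ge0.
by rewrite integral_indic ?setIT//; exact: mE.
Qed.

End levels.

Let near_exprV (e : R) : (0 < e)%R -> \forall N \near \oo, (b ^- N < e)%R.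
Proof.
move=> e0; have : (b^-1 ^+ n @[n --> \oo] --> (0 : R))%R.
  by apply: cvg_expr; rewrite ger0_norm ?invr_ge0 ?ltW// invf_lt1.
move=> /cvgr_lt /(_ e e0); apply: filterS => N.
by rewrite exprVn.
Qed.

Lemma good_lambda_constant_gt0 :
  (0 < Cq)%R /\ (0 < b `^ p * (2 * b `^ p * c * Cq))%R.
Proof.
have bp0 : (0 < b `^ p)%R by exact: powR_gt0.
have Cq0 : (0 < Cq)%R.
  rewrite /Cq; apply: mulr_gt0; last by rewrite powR_gt0// invr_gt0.
  by rewrite divr_gt0 ?powR_gt0// subr_gt0.
split => //; apply: mulr_gt0 => //; apply: mulr_gt0 => //.
by rewrite !mulr_gt0.
Qed.

(** Any value slightly below [u x] lies between two consecutive levels once [N] is large, so the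
    power of [u] is at most the lower limit of the step functions [v N]. Fatou's lemma applies, and
    the contribution of the lowest level vanishes as [N] grows because [q] is positive and [f] is
    integrable. *)
Lemma marcinkiewicz_good_lambda :
  \int[mu]_x (u x `^ p) <=
  (b `^ p * (2 * b `^ p * c * Cq))%:E * \int[mu]_x ((f x) `^ p)%:E.
Proof.
pose lam N k : R := (b ^- N * b ^+ k)%R.
pose v N x := (b `^ p)%:E * \sum_(k < (N + N).+1)
     ((lam N k `^ p)%:E * (\1_(level (lam N k)) x : R)%:E).
have l1 N k x : 0 <= (lam N k `^ p)%:E * (\1_(level (lam N k)) x : R)%:E.
  by rewrite mule_ge0 ?lee_fin ?powR_ge0.
have v0 N x : 0 <= v N x.
  by rewrite mule_ge0 ?lee_fin ?powR_ge0//; exact: sume_ge0.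
have mv N : measurable_fun [set: X] (v N).
  apply: emeasurable_funM => //; apply: emeasurable_sum => k.
  apply: emeasurable_funM => //; apply/measurable_EFinP;
    apply: measurable_indic.
  exact: mE.
apply: (@le_trans _ _ (\int[mu]_x limn_einf (v^~ x))).
  apply: ge0_le_integralW => x _; first exact: poweR_ge0.
  rewrite leNgt; apply/negP => /ereal_between[|r vr ru].
    by apply: limn_einf_ge_near; apply: nearW.
  have r0 : (0 <= r)%R.
    rewrite -lee_fin; apply: le_trans (ltW vr).
    by apply: limn_einf_ge_near; apply: nearW.
  have rp0 : 0 <= (r `^ p^-1)%:E by rewrite lee_fin powR_ge0.
  have [||s rs su] := @ereal_between R (r `^ p^-1)%:E (u x) => //.
    exact: lt_poweR_root.
  have s0 : (0 < s)%R by rewrite -lte_fin; exact: le_lt_trans rs.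
  suff : r%:E <= limn_einf (v^~ x) by rewrite leNgt vr.
  apply: limn_einf_ge_near; near=> N.
  have [k kN /andP[ks sk]] : exists2 k : nat, (k < (N + N).+1)%N &
      (lam N k < s <= b * lam N k)%R.
    apply: level_below => //; first by near: N; exact: near_exprV.
    rewrite -[leRHS]invrK -[leLHS]invrK lef_pV2 ?posrE ?invr_gt0 ?exprn_gt0//.
    by apply/ltW; near: N; apply: near_exprV; rewrite invr_gt0.
  apply: (@le_trans _ _ ((b `^ p)%:E * (lam N k `^ p)%:E)).
    have lam0 : (0 < lam N k)%R by rewrite mulr_gt0 ?invr_gt0 ?exprn_gt0.
    rewrite -EFinM -powRM; [|exact: ltW|exact: ltW].
    rewrite lee_fin (_ : r = ((r `^ p^-1) `^ p)%R); last first.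
      by rewrite -powRrM mulVf ?gt_eqF// powRr1.
    apply: ge0_ler_powR; rewrite ?nnegrE ?powR_ge0 ?(ltW p0)//.
      by rewrite mulr_ge0 ?(ltW b0) ?(ltW lam0).
    by apply: le_trans sk; apply: ltW; rewrite -lte_fin.
  rewrite /v lee_wpmul2l ?lee_fin ?powR_ge0//.
  rewrite (bigD1 (Ordinal kN))//= indicE mem_set/= ?mule1; last first.
    by apply: lt_trans su; rewrite lte_fin.
  by rewrite leeDl// sume_ge0.
apply: le_trans; first exact: fatou.
have [Cq0 K0] := good_lambda_constant_gt0.
have fp0 : 0 <= \int[mu]_x ((f x) `^ p)%:E.
  by apply: integral_ge0 => x _; rewrite lee_fin powR_ge0.
have [fpoo|] := ltP (\int[mu]_x ((f x) `^ p)%:E) +oo; last first.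
  by rewrite leye_eq => /eqP ->; rewrite gt0_muley ?leey// lte_fin.
apply/lee_addgt0Pr => e e0; apply: limn_einf_le_near.
pose C := (b `^ p * 2 * c * fine (\int[mu]_x (f x)%:E))%R.
have C0 : (0 <= C)%R.
  apply: mulr_ge0; first by rewrite !mulr_ge0 ?powR_ge0 ?(ltW c0).
  by apply: fine_ge0; apply: integral_ge0 => x _; rewrite lee_fin.
near=> N; apply: le_trans (integral_levels_le N) _.
rewrite ge0_muleDr; last 2 first.
- rewrite mule_ge0// ?lee_fin; first by rewrite !mulr_ge0 ?powR_ge0 ?(ltW c0).
  by apply: integral_ge0 => x _; rewrite lee_fin.
- apply: mule_ge0 => //; rewrite lee_fin; apply: mulr_ge0; last exact: ltW.
  by rewrite !mulr_ge0 ?powR_ge0 ?(ltW c0).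
rewrite addeC muleA -EFinM leeD2l//.
rewrite -(fineK (finint measurableT)) -!EFinM lee_fin.
have -> : (b `^ p * (2 * (b ^- N) `^ q * c * fine (\int[mu]_x (f x)%:E)) =
    C * (b ^- N) `^ q)%R.
  by rewrite /C; ring.
(* With [b ^- N] this small the term of the lowest level is at most [C * (e / (C + 1))], hence at
   most [e]. *)
have bN : (b ^- N < (e / (C + 1)) `^ q^-1)%R.
  near: N; apply: near_exprV; rewrite powR_gt0// divr_gt0// ltr_wpDl//.
apply: (@le_trans _ _ (C * (e / (C + 1)))%R).
  rewrite ler_wpM2l//.
  have eC0 : (0 <= e / (C + 1))%R by rewrite divr_ge0 ?(ltW e0)// addr_ge0.
  rewrite (_ : e / (C + 1) = ((e / (C + 1)) `^ q^-1) `^ q)%R; last first.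
    by rewrite -powRrM mulVf ?gt_eqF// powRr1.
  apply: ge0_ler_powR; rewrite ?nnegrE ?powR_ge0 ?(ltW q0) ?(ltW bN)//.
  by rewrite invr_ge0 exprn_ge0// ltW.
rewrite mulrCA ger_pMr// ler_pdivrMr ?mul1r ?lerDl// ltr_wpDl//.
Unshelve. all: by end_near. Qed.

End marcinkiewicz.

(** * From weak type to strong type *)

Section weak_to_strong.
Context {T : ptopologicalType} {R : realType}.
Variable sigma : {measure set (borel T) -> \bar R}.
Variable G : T -> T -> \bar R.
Hypotheses (lcT : locally_compact [set: T]) (hT : hausdorff_space T)
  (scT : @second_countable T) (sigma_lf : locally_finite sigma)
  (G0 : forall x y : T, 0 <= G x y)
  (Glsc : lower_semicontinuous (fun z : T * T => G z.1 z.2)).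
Variables (h c : R).
Hypotheses (h1 : (1 <= h)%R) (wmp : weak_maximum_principle G h) (c0 :
  (0 < c)%R).
Hypothesis weak : forall nu, locally_finite nu ->
  weak_L1_norm sigma (potential G nu) <= c%:E * nu [set: borel T].

Let mG (x : T) : measurable_fun [set: borel T] (G x : borel T -> \bar R).
Proof. by apply: lsc_measurable; exact: lsc_sectionl. Qed.

Let pot (f : borel T -> R) (x : T) := \int[sigma]_y (G x y * (f y)%:E).

Section nonnegative_density.
Variable f : borel T -> R.
Hypotheses (f0 : forall x, (0 <= f x)%R) (mf : measurable_fun [set: borel T] f).

Let potE x : pot f x = \int[mdensity sigma f0 mf]_y G x y.
Proof. by rewrite integral_mdensity. Qed.

Lemma density_potential_ge0 x : 0 <= pot f x.
Proof. by rewrite potE; exact: integral_ge0. Qed.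

Lemma lsc_density_potential : lower_semicontinuous (pot f).
Proof.
rewrite (_ : pot f = fun x => \int[mdensity sigma f0 mf]_y G x y).
  exact: lsc_potential.
by apply/funext => x; exact: potE.
Qed.

Lemma weak_type_density (t : R) : \int[sigma]_x (f x)%:E < +oo -> (0 < t)%R ->
  t%:E * sigma [set x | t%:E < pot f x] <= c%:E * \int[sigma]_x (f x)%:E.
Proof.
move=> foo t0.
have := weak (finite_mdensity_locally_finite f0 mf foo).
apply: le_trans; apply: ereal_sup_ubound; exists t => //; congr (_ * sigma _).
apply/seteqP; split=> x; rewrite /= /potential -potE gee0_abs//;
  exact: density_potential_ge0.
Qed.

End nonnegative_density.

(* By the maximum principle the part of f living where its potential is at most
   t has potential at most h * t everywhere, so that where the potential exceeds
   2 * h * t the other part contributes more than h * t. *)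
Lemma good_lambda_density (f : borel T -> R) (t : R) :
  (forall x, (0 <= f x)%R) -> measurable_fun [set: borel T] f ->
  \int[sigma]_x (f x)%:E < +oo -> (0 < t)%R ->
  t%:E * sigma [set x | (2 * h * t)%:E < pot f x] <=
    c%:E * \int[sigma]_(x in [set x | t%:E < pot f x]) (f x)%:E.
Proof.
move=> f0 mf foo t0; set A := [set x | t%:E < pot f x].
have h0 : (0 < h)%R by exact: lt_le_trans h1.
have oA : open (A : set T).
  exact: (lower_semicontinuousP _).1 (lsc_density_potential f0 mf) t.
have mA : measurable (A : set (borel T)) by exact: borel_open.
pose f1 x : R := (f x * \1_(~` A) x)%R.
pose f2 x : R := (f x * \1_A x)%R.
have f10 x : (0 <= f1 x)%R by rewrite mulr_ge0.
have f20 x : (0 <= f2 x)%R by rewrite mulr_ge0.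
have mf1 : measurable_fun [set: borel T] f1.
  by apply: measurable_funM => //; apply: measurable_indic; exact: measurableC.
have mf2 : measurable_fun [set: borel T] f2.
  by apply: measurable_funM => //; exact: measurable_indic.
have f1f x : (f1 x <= f x)%R by rewrite ler_piMr// indicE; case: (_ \in _).
have f2f x : (f2 x <= f x)%R by rewrite ler_piMr// indicE; case: (_ \in _).
have lty (k : borel T -> R) : (forall x, 0 <= k x)%R ->
  (forall x, k x <= f x)%R ->
    \int[sigma]_x (k x)%:E < +oo.
  move=> k0 kf; apply: le_lt_trans foo; apply: ge0_le_integralW => x _.
    by rewrite lee_fin.
  by rewrite lee_fin.
have fE x : f x = (f1 x + f2 x)%R.
  rewrite /f1 /f2 !indicE in_setC; case: (_ \in _) => /=.
    by rewrite mulr0 mulr1 add0r.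
  by rewrite mulr0 mulr1 addr0.
have uE x : pot f x = pot f1 x + pot f2 x.
  rewrite /pot -ge0_integralD//.
  - by apply: eq_integral => y _; rewrite fE EFinD ge0_muleDr// lee_fin.
  - by move=> y _; rewrite mule_ge0// lee_fin.
  - by apply: emeasurable_funM => //; exact/measurable_EFinP.
  - by move=> y _; rewrite mule_ge0// lee_fin.
  - by apply: emeasurable_funM => //; exact/measurable_EFinP.
have u1 x : pot f1 x <= (h * t)%:E.
  apply: (@max_principle_density _ _ sigma G G0 Glsc h t f1 (~` A)) => //.
  - exact: lty.
  - exact: open_closedC.
  - by move=> y nAy; rewrite /f1 indicE memNset ?mulr0.
  - move=> y; rewrite /A /= => /negP; rewrite -leNgt; apply: le_trans.
    rewrite -/(pot f1 y) uE leeDl//; exact: density_potential_ge0.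
have f2E : \int[sigma]_x (f2 x)%:E = \int[sigma]_(x in A) (f x)%:E.
  rewrite [RHS]integral_mkcond; apply: eq_integral => x _.
  by rewrite patchE /f2 indicE; case: ifPn => _; rewrite ?mulr1 ?mulr0.
rewrite -f2E; apply: (@le_trans _ _ ((h * t)%:E * sigma [set x | (h *
  t)%:E < pot f2 x])).
  apply: lee_pmul => //; first by rewrite lee_fin ltW.
    by rewrite lee_fin ler_peMl// ltW.
  apply: measureS.
  - apply: borel_open.
    exact: (lower_semicontinuousP _).1 (lsc_density_potential f0 mf) _.
  - apply: borel_open.
    exact: (lower_semicontinuousP _).1 (lsc_density_potential f20 mf2) _.
  - move=> x /=; apply: contraTT; rewrite -!leNgt => u2.
    rewrite uE (_ : 2 * h * t = h * t + h * t)%R; last by ring.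
    by rewrite EFinD leeD.
apply: weak_type_density => //; first exact: lty.
by rewrite mulr_gt0.
Qed.

Lemma strong_type_density (p : R) : (1 < p)%R -> exists2 C : R, (0 < C)%R &
  forall f : borel T -> R, (forall x, (0 <= f x)%R) ->
    measurable_fun [set: borel T] f -> \int[sigma]_x (f x)%:E < +oo ->
    \int[sigma]_x (pot f x `^ p) <= C%:E * \int[sigma]_x (f x `^ p)%:E.
Proof.
move=> p1; have h0 : (0 < h)%R by exact: lt_le_trans h1.
have b1 : (1 < 2 * h)%R by rewrite (lt_le_trans (y := 2%R)) ?ltr1n// ler_peMr.
have b0 : (0 < 2 * h)%R by exact: lt_trans b1.
(* The constant is read off from the interpolation lemma with ratio [2 * h]. *)
eexists; last first.
  move=> f f0 mf foo; apply: (marcinkiewicz_good_lambda b1 c0 p1) => //.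
  - by apply: lsc_measurable; exact: lsc_density_potential.
  - exact: density_potential_ge0.
  - by move=> t t0; exact: weak_type_density.
  - by move=> t t0; exact: good_lambda_density.
by have [] := good_lambda_constant_gt0 b1 c0 p1.
Qed.

(** A function in Lp need not be integrable, so its modulus is first cut down to the sets [D n], on
    which it is bounded and which have finite measure. The potentials of the cut functions increase
    to that of the modulus, and Fatou's lemma passes to the limit. *)
Lemma weak_type_strong_type : strong_type_bound G sigma.
Proof.
move=> p p1; have [C C0 CP] := strong_type_density p1.
have p0 : (0 < p)%R by exact: lt_trans p1.
have pn0 : p != 0%R by rewrite gt_eqF.
exists (C `^ p^-1)%R; first exact: powR_gt0.
move=> f /andP[/[!inE] mf _].
have [K [cK ndK KT]] := open_compact_exhaustion scT lcT hT openT.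
pose D n := K n `&` [set x : borel T | `|f x| <= n%:R]%R.
have mnf : measurable_fun [set: borel T] (fun y =>
  `|f y|%R) by exact: measurableT_comp.
have mD n : measurable (D n : set (borel T)).
  apply: measurableI; first exact: borel_compact.
  rewrite (_ : [set x | _] =
      [set: borel T] `&` [set x | (EFin \o (fun y => `|f y|%R)) x <= n%:R%:E]).
    by apply: emeasurable_fun_infty_c => //; exact/measurable_EFinP.
  by rewrite setTI; apply/seteqP; split => x /=; rewrite lee_fin.
have ndD : nondecreasing_seq D.
  move=> m n mn; apply/subsetPset => x [Kx fx]; split.
    by move: x Kx {fx}; apply/subsetPset/ndK.
  by rewrite /= (le_trans fx)// ler_nat.
have DT : \bigcup_n D n = setT.
  apply/seteqP; split => // x _.
  have [m _ Kx] : (\bigcup_n K n) x by rewrite -KT.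
  exists (maxn m (Num.truncn `|f x|%R).+1) => //; split.
    by have /subsetPset := ndK _ _ (leq_maxl m (Num.truncn `|f x|%R).+1); apply.
  by rewrite /= (le_trans (ltW (truncnS_gt _)))// ler_nat leq_maxr.
pose g n x : R := (`|f x| * \1_(D n) x)%R.
have g0 n x : (0 <= g n x)%R by rewrite mulr_ge0.
have mg n : measurable_fun [set: borel T] (g n).
  by apply: measurable_funM => //; exact: measurable_indic.
have goo n : \int[sigma]_x (g n x)%:E < +oo.
  apply: (@le_lt_trans _ _ (\int[sigma]_(x in D n) (cst n%:R%:E) x)).
    rewrite [leRHS]integral_mkcond; apply: ge0_le_integralW => x _.
      by rewrite lee_fin.
    rewrite patchE /g indicE; case: ifPn => [|_]; last by rewrite mulr0.
    by rewrite inE mulr1 lee_fin => -[].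
  rewrite integral_cst// lte_mul_pinfty//.
  apply: le_lt_trans (compact_finite_measure hT sigma_lf (cK n)).
  by apply: measureS => //; [exact: borel_compact|move=> x []].
pose u x := \int[sigma]_y (G x y * `|f y|%:E).
have Gf0 x y : 0 <= G x y * `|f y|%:E by rewrite mule_ge0.
have mGf x : measurable_fun [set: borel T] (fun y => G x y * `|f y|%:E).
  by apply: emeasurable_funM => //; exact/measurable_EFinP.
have potg n x : pot (g n) x = \int[sigma]_(y in D n) (G x y * `|f y|%:E).
  rewrite /pot [RHS]integral_mkcond; apply: eq_integral => y _.
  rewrite patchE /g indicE; case: ifPn => _; first by rewrite mulr1.
  by rewrite mulr0 mule0.
have ndg x : nondecreasing_seq (fun n => pot (g n) x).
  move=> m n mn; rewrite !potg; apply: ge0_subset_integral => //.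
    exact: measurable_funTS.
  exact/subsetPset/ndD.
have gu x : pot (g n) x @[n --> \oo] --> u x.
  rewrite /u -DT; under eq_fun do rewrite potg.
  apply: ge0_nondecreasing_set_cvg_integral => // n.
  exact: measurable_funTS.
have u0 x : 0 <= u x by exact: integral_ge0.
have up : \int[sigma]_x (u x `^ p) <= C%:E * \int[sigma]_x (`|f x| `^ p)%:E.
  apply: (@le_trans _ _ (\int[sigma]_x limn_einf (fun n => pot (g n) x `^ p))).
    apply: ge0_le_integralW => x _; first exact: poweR_ge0.
    rewrite leNgt; apply/negP => /ereal_between[|r vr ru].
      by apply: limn_einf_ge_near; apply: nearW => n; exact: poweR_ge0.
    have r0 : (0 <= r)%R.
      rewrite -lee_fin; apply: le_trans (ltW vr).
      by apply: limn_einf_ge_near; apply: nearW => n; exact: poweR_ge0.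
    suff : r%:E <= limn_einf (fun n => pot (g n) x `^ p) by rewrite leNgt vr.
    have su := lt_poweR_root p0 r0 (u0 x) ru.
    have [n0 sn0] : exists n, (r `^ p^-1)%:E < pot (g n) x.
      apply: contrapT => nsn; move: su; rewrite ltNge => /negP; apply.
      have /cvg_lim <- // := gu x; apply: lime_le; first by apply: cvgP (gu x).
      by apply: nearW => n; rewrite leNgt; apply/negP => sn; apply: nsn;
        exists n.
    apply: limn_einf_ge_near; exists n0 => // n /= n0n.
    have : (r `^ p^-1)%:E `^ p <= pot (g n) x `^ p.
      apply: gt0_ler_poweR; rewrite ?(ltW p0)// ?in_itv/= ?leey ?andbT.
      + by rewrite lee_fin powR_ge0.
      + exact: density_potential_ge0.
      + by apply: le_trans (ltW sn0) _; exact: ndg.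
    by rewrite poweR_EFin -powRrM mulVf// powRr1.
  apply: le_trans; first apply: fatou => //.
  - move=> n; apply: (measurableT_comp (measurable_poweR p)).
    by apply: lsc_measurable; exact: lsc_density_potential.
  - by move=> n x _; exact: poweR_ge0.
  apply: limn_einf_le_near; apply: nearW => n.
  apply: le_trans (CP _ (g0 n) (mg n) (goo n)) _.
  apply: lee_wpmul2l; first by rewrite lee_fin ltW.
  apply: ge0_le_integralW => x _; rewrite lee_fin ?powR_ge0//.
  apply: ge0_ler_powR; rewrite ?nnegrE ?(ltW p0)//.
  by rewrite ler_piMr// indicE; case: (_ \in _).
rewrite unlock -poweR_EFin -poweRM; last 2 first.
- by rewrite lee_fin ltW.
- by apply: integral_ge0 => x _; exact: poweR_ge0.
(* This holds also where the integral of the signed density is infinite or takes its conventional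
   value. *)
have pd x : `|potential_density G sigma f x| <= u x.
  rewrite /potential_density;
    apply: (@le_trans _ _ (\int[sigma]_y `|G x y * (f y)%:E|)).
    apply: le_abse_integral => //; apply: emeasurable_funM => //.
    exact/measurable_EFinP.
  apply: ge0_le_integralW => // y _.
  by rewrite abseM gee0_abs.
apply: gt0_ler_poweR; rewrite ?invr_ge0 ?(ltW p0)// ?in_itv/= ?leey ?andbT.
- by apply: integral_ge0 => x _; exact: poweR_ge0.
- apply: mule_ge0; first by rewrite lee_fin ltW.
  by apply: integral_ge0 => x _; rewrite lee_fin powR_ge0.
apply: le_trans up; apply: ge0_le_integralW => x _; first exact: poweR_ge0.
apply: gt0_ler_poweR; rewrite ?(ltW p0)// ?in_itv/= ?leey ?andbT//.
Qed.

End weak_to_strong.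

(** * Truncated quasi-metric kernels *)

Section finite_vitali.
Context {I : choiceType} {X : Type}.
Variables (B : I -> set X) (j : I -> nat).

(** Greedy selection: take a ball of largest index, discard those that meet it, and recurse. The
    index will be the exponent of the radius. *)
Lemma finite_vitali (s : seq I) : exists s' : seq I,
  [/\ {subset s' <= s}, pairwise (fun x y => `[< B x `&` B y = set0 >]) s' &
      forall x, x \in s -> B x !=set0 ->
        exists2 z, z \in s' & (j x <= j z)%N /\ B x `&` B z !=set0].
Proof.
have [n] := ubnP (size s); elim: n s => // n ih s sn.
have [->|s0] := eqVneq s [::]; first by exists [::].
have [z zs zmax] : exists2 z, z \in s & forall x, x \in s -> (j x <= j z)%N.
  elim: s s0 {sn} => // a [|a' s] ihs _.
    by exists a; rewrite ?mem_head// => x; rewrite inE => /eqP ->.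
  have [//|z zs zmax] := ihs.
  have [az|za] := leqP (j a) (j z).
    exists z; first by rewrite inE zs orbT.
    by move=> x; rewrite inE => /predU1P[->//|/zmax].
  exists a; first exact: mem_head.
  by move=> x; rewrite inE => /predU1P[->//|/zmax /leq_trans]; apply;
    exact: ltnW.
pose disj x := `[< B z `&` B x = set0 >].
pose s1 := [seq x <- s | (x != z) && disj x].
have [|s' [s's1 ps' cs']] := ih s1.
  rewrite -ltnS; apply: leq_trans sn; rewrite ltnS /s1 size_filter.
  rewrite ltn_neqAle count_size andbT -all_count.
  by apply/negP => /allP /(_ z zs); rewrite eqxx.
exists (z :: s'); split.
- move=> x; rewrite inE => /predU1P[->//|/s's1].
  by rewrite mem_filter => /andP[].
- rewrite /= ps' andbT; apply/allP => x /s's1.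
  by rewrite mem_filter => /andP[/andP[]].
- move=> x xs Bx; have [dx|ndx] := boolP (disj x).
    have [xz|xz] := eqVneq x z.
      exists z; first exact: mem_head.
      by rewrite xz; split => //; rewrite setIid -xz.
    have [|//|y ys' [jxy Bxy]] := cs' x; first by rewrite mem_filter xz dx.
    by exists y => //; rewrite inE ys' orbT.
  exists z; first exact: mem_head.
  split; first exact: zmax.
  by apply/set0P; move/asboolPn: ndx => /eqP; rewrite setIC.
Qed.

End finite_vitali.

Lemma measure_pairwise_disjoint d (X : measurableType d) (R : realType)
    (mu : {measure set X -> \bar R}) (I : choiceType) (B : I ->
      set X) (s : seq I) :
  (forall i, measurable (B i)) ->
  pairwise (fun x y => `[< B x `&` B y = set0 >]) s ->
  \sum_(i <- s) mu (B i) = mu (\big[setU/set0]_(i <- s) B i).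
Proof.
move=> mB; elim: s => [|i s ih] /=; first by rewrite !big_nil measure0.
move=> /andP[/allP is_ /ih sE]; rewrite !big_cons sE measureU//.
  exact: bigsetU_measurable.
rewrite -bigcup_seq setI_bigcupr bigcup0// => k /= /is_.
by move/asboolP.
Qed.

Section quasi_metric.
Context {T : ptopologicalType} {R : realType}.
Variable sigma : {measure set (borel T) -> \bar R}.
Hypotheses (lcT : locally_compact [set: T]) (hT : hausdorff_space T)
  (scT : @second_countable T) (sigma_lf : locally_finite sigma).
Variables (D : T -> T -> R) (kappa delta c0 c : R).
Hypotheses (kappa1 : (1 <= kappa)%R) (delta0 : (0 < delta)%R)
  (c0_gt0 : (0 < c0)%R) (c_gt0 : (0 < c)%R).
Hypotheses (Dsym : forall x y, D x y = D y x)
  (Dtri : forall x y z, (D x y <= kappa * (D x z + D z y))%R).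

Definition qball x (r : R) : set T := [set y | (D x y < r)%R].
(** The reciprocal of [D] capped at [delta^-1], so that sets of finite measure have bounded
    potentials. *)
Definition trunc_kernel x y : \bar R := ((Num.max (D x y) delta)^-1)%:E.
Definition trunc_potential (E : set T) (x : T) : \bar R :=
  \int[sigma]_(y in E) trunc_kernel x y.

Local Notation k := trunc_kernel.
Local Notation pk := trunc_potential.

Hypotheses (oB : forall x r, open (qball x r))
  (klsc : lower_semicontinuous (fun z : T * T => k z.1 z.2))
  (growth : forall x (r : R), (0 < r)%R -> sigma (qball x r) <= (c0 * r)%:E)
  (test : forall z (r : R), (0 < r)%R ->
    \int[sigma]_(x in qball z r) pk (qball z r) x <= c%:E * sigma (qball z r)).

Let kappa0 : (0 < kappa)%R. Proof. exact: lt_le_trans kappa1. Qed.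

Let mx_gt0 x y : (0 < Num.max (D x y) delta)%R.
Proof. by rewrite lt_max delta0 orbT. Qed.

Let k0 x y : 0 <= k x y.
Proof. by rewrite lee_fin invr_ge0 ltW. Qed.

Let k_le x y (r : R) : (0 < r)%R -> (r <= Num.max (D x y) delta)%R ->
  k x y <= (r^-1)%:E.
Proof. by move=> r0 rD; rewrite lee_fin lef_pV2 ?posrE. Qed.

Let k_comp x x' y (C : R) : (0 < C)%R ->
  (Num.max (D x' y) delta <= C * Num.max (D x y) delta)%R ->
  k x y <= C%:E * k x' y.
Proof.
move=> C0 xx'; rewrite /trunc_kernel -EFinM lee_fin -ler_pdivrMl//.
by rewrite -invfM lef_pV2 ?posrE// mulr_gt0.
Qed.

Let mk x : measurable_fun [set: borel T] (k x : borel T -> \bar R).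
Proof. by apply: lsc_measurable; exact: (lsc_sectionl klsc). Qed.

Let mB x r : measurable (qball x r : set (borel T)).
Proof. exact: borel_open. Qed.

Let Bfin x r : sigma (qball x r) \is a fin_num.
Proof.
rewrite ge0_fin_numE//; apply: (@le_lt_trans _ _ (c0 * Num.max r 1)%:E);
  last exact: ltry.
apply: (@le_trans _ _ (sigma (qball x (Num.max r 1)%R))); last first.
  by apply: growth; rewrite lt_max ltr01 orbT.
by apply: measureS => // y /= Dr; rewrite /qball/= lt_max Dr.
Qed.

Let pk0 E x : 0 <= pk E x. Proof. exact: integral_ge0. Qed.

Let pk_open E (t : R) : measurable (E : set (borel T)) ->
  open [set x : T | t%:E < pk E x].
Proof.
move=> mE; exact: (lower_semicontinuousP _).1 (lsc_potential klsc k0 scT mE) t.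
Qed.

Let mpk E : measurable (E : set (borel T)) ->
  measurable_fun [set: borel T] (pk E : borel T -> \bar R).
Proof. by move=> mE; apply: lsc_measurable; exact: lsc_potential. Qed.

Let pkS E F x : measurable (E : set (borel T)) ->
  measurable (F : set (borel T)) ->
  E `<=` F -> pk E x <= pk F x.
Proof.
by move=> mE mF EF; apply: ge0_subset_integral => //; exact: measurable_funTS.
Qed.

(* Compare with an almost nearest point of F. *)
Lemma trunc_max_principle (F : set T) (M : R) :
  measurable (F : set (borel T)) -> (0 <= M)%R ->
  (forall x, F x -> pk F x <= M%:E) -> forall x, pk F x <= (3 * kappa * M)%:E.
Proof.
move=> mF M0 FM x.
have [->|/set0P F0] := eqVneq F set0.
  by rewrite /trunc_potential integral_set0 lee_fin !mulr_ge0// ltW.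
pose S := [set Num.max (D x y) delta | y in F].
have infS : has_inf S.
  split; first by case: F0 => y Fy; exists (Num.max (D x y) delta); exists y.
  by exists delta => _ [y _ <-]; rewrite le_max lexx orbT.
have dS : (delta <= inf S)%R.
  by apply: lb_le_inf infS.1 _ => _ [y _ <-]; rewrite le_max lexx orbT.
have iS0 : (0 < inf S)%R by exact: lt_le_trans dS.
have [_ [y0 Fy0 <-] y0S] := inf_adherent iS0 infS.
have near y : F y -> (Num.max (D x y0) delta <= 2 * Num.max (D x y) delta)%R.
  move=> Fy; apply: le_trans (ltW y0S) _.
  have : (inf S <= Num.max (D x y) delta)%R by apply: (ge_inf infS.2); exists y.
  lra.
apply: (@le_trans _ _ ((3 * kappa)%:E * pk F y0)); last first.
  rewrite [leRHS]EFinM; apply: lee_wpmul2l; last exact: FM.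
  by rewrite lee_fin mulr_ge0// ltW.
rewrite /trunc_potential -ge0_integralZl//; last 2 first.
- exact: measurable_funTS.
- by rewrite lee_fin mulr_ge0// ltW.
apply: ge0_le_integralW => // y Fy; apply: k_comp; first by rewrite mulr_gt0.
have := near y Fy; set m := Num.max (D x y) delta => nm.
have Dm : (D x y <= m)%R by rewrite le_max lexx.
have dm : (delta <= m)%R by rewrite le_max lexx orbT.
have D0m : (D x y0 <= 2 * m)%R by apply: le_trans nm; rewrite le_max lexx.
rewrite ge_max; apply/andP; split; last first.
  by apply: (le_trans dm); rewrite ler_peMl ?(le_trans (ltW delta0))//;
    have := kappa1; lra.
apply: (le_trans (Dtri y0 y x)); rewrite (Dsym y0 x).
have -> : (3 * kappa * m = kappa * (2 * m + m))%R by ring.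
by rewrite ler_wpM2l ?(ltW kappa0)// lerD.
Qed.

(** For [y] at distance at least [r] from [x], moving [x] to [x'] multiplies the distance to [y] by
    at most [kappa * (b + 1)]. *)
Lemma far_potential_le (E : set T) (x x' : T) (r b : R) :
  measurable (E : set (borel T)) -> (0 < r)%R -> (0 < b)%R ->
    (D x x' < b * r)%R ->
  pk (E `\` qball x r) x <= (kappa * (b + 1))%:E * pk E x'.
Proof.
move=> mE r0 b0 xx'.
apply: (@le_trans _ _ ((kappa * (b + 1))%:E * pk (E `\` qball x r) x')).
  rewrite /trunc_potential -ge0_integralZl//; last 3 first.
  - by apply: measurableD.
  - exact: measurable_funTS.
  - by rewrite lee_fin mulr_ge0 ?addr_ge0// ltW.
  apply: ge0_le_integralW => // y [_ /negP]; rewrite /qball/= -leNgt => ry.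
  apply: k_comp; first by rewrite mulr_gt0 ?addr_gt0.
  set m := Num.max (D x y) delta.
  have Dm : (D x y <= m)%R by rewrite le_max lexx.
  have dm : (delta <= m)%R by rewrite le_max lexx orbT.
  have m0 : (0 < m)%R by exact: lt_le_trans dm.
  rewrite ge_max; apply/andP; split; last first.
    apply: (le_trans dm); rewrite ler_peMl ?(ltW m0)//.
    by rewrite mulr_ege1// lerDr ltW.
  apply: (le_trans (Dtri x' y x)); rewrite -mulrA ler_wpM2l ?(ltW kappa0)//.
  rewrite mulrDl mul1r lerD// Dsym (le_trans (ltW xx'))// ler_wpM2l ?(ltW b0)//.
  exact: le_trans ry Dm.
apply: lee_wpmul2l; first by rewrite lee_fin mulr_ge0 ?addr_ge0// ltW.
by apply: pkS => //; exact: measurableD.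
Qed.

Lemma trunc_potential_small_ball x : pk (qball x delta) x <= c0%:E.
Proof.
apply: (@le_trans _ _ (\int[sigma]_(y in qball x delta) (delta^-1)%:E)).
  apply: ge0_le_integralW => // y _; apply: k_le => //.
  by rewrite le_max lexx orbT.
rewrite integral_cst//;
  apply: (@le_trans _ _ ((delta^-1)%:E * (c0 * delta)%:E)).
  by apply: lee_wpmul2l; [rewrite lee_fin invr_ge0 ltW|exact: growth].
by rewrite -EFinM lee_fin mulrC -mulrA divff ?mulr1// gt_eqF.
Qed.

(** * Potentials of concentric balls and doubling scales *)

Section scales.
Variables (b : R) (x : T).
Hypothesis b1 : (1 <= b)%R.

Let r j : R := (delta * b ^+ j)%R.
Let m j : R := fine (sigma (qball x (r j))).
Let qm j : R := (m j / r j)%R.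

Let b0 : (0 < b)%R. Proof. exact: lt_le_trans b1. Qed.
Let r0 j : (0 < r j)%R. Proof. by rewrite mulr_gt0// exprn_gt0. Qed.
Let rS j : r j.+1 = (b * r j)%R. Proof. by rewrite /r exprS mulrCA. Qed.

Let mE j : sigma (qball x (r j)) = (m j)%:E. Proof. by rewrite fineK//;
  exact: Bfin. Qed.

Let qm_le j : (qm j <= c0)%R.
Proof. by rewrite ler_pdivrMr// -lee_fin -mE; exact: growth. Qed.

Let qm_ge0 j : (0 <= qm j)%R.
Proof. by rewrite divr_ge0 ?(ltW (r0 j))// fine_ge0. Qed.

Let pk_ball0 : pk (qball x (r 0%N)) x <= (qm 0%N)%:E.
Proof.
apply: (@le_trans _ _ (\int[sigma]_(y in qball x (r 0%N)) ((r 0%N)^-1)%:E)).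
  apply: ge0_le_integralW => // y _; apply: k_le => //.
  by rewrite /r expr0 mulr1 le_max lexx orbT.
by rewrite integral_cst// mE -EFinM mulrC.
Qed.

Let pk_ballS j : pk (qball x (r j.+1)) x <=
  pk (qball x (r j)) x + (b * qm j.+1)%:E.
Proof.
have rr : qball x (r j) `<=` qball x (r j.+1).
  by move=> y /= /lt_le_trans; apply; rewrite rS ler_peMl// ltW.
have mD : measurable (qball x (r j.+1) `\` qball x (r j) : set (borel T)).
  exact: measurableD.
rewrite {1}/trunc_potential -(setDUK rr) ge0_integral_setU//; last 2 first.
- by rewrite setDUK//; exact: measurable_funTS.
- by apply/disj_setPS => y [? []].
rewrite leeD2l//.
apply: (@le_trans _ _ (\int[sigma]_(y in qball x (r j.+1) `\` qball x (r j))
  ((r j)^-1)%:E)).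
  apply: ge0_le_integralW => // y [_ /negP]; rewrite /qball/= -leNgt => rD.
  by apply: k_le => //; rewrite le_max rD.
rewrite integral_cst//.
apply: (@le_trans _ _ (((r j)^-1)%:E * sigma (qball x (r j.+1)))).
  by apply: lee_wpmul2l;
    [rewrite lee_fin invr_ge0 ltW|apply: measureS => // y []].
rewrite mE -EFinM lee_fin /qm rS le_eqVlt; apply/orP; left; apply/eqP.
by field; rewrite !gt_eqF.
Qed.

(* Between two doubling scales the measure of a ball outgrows its radius
   geometrically, so that non-doubling scales contribute a bounded amount. *)
Lemma potential_at_doubling_scale i :
  (exists j, [/\ (j <= i)%N,
    sigma (qball x (r j.+1)) <= (2 * b)%:E * sigma (qball x (r j)) &
    pk (qball x (r i)) x <= pk (qball x (r j)) x + (2 * b * c0)%:E]) \/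
  pk (qball x (r i)) x <= (2 * b * c0)%:E.
Proof.
(* The induction carries [qm i.+1] in place of [c0]: this ratio at least doubles across a
   non-doubling scale, which makes room for the next annulus. *)
suff : (exists j, [/\ (j <= i)%N, (m j.+1 <= 2 * b * m j)%R &
    pk (qball x (r i)) x <= pk (qball x (r j)) x + (2 * b * qm i.+1)%:E]) \/
    pk (qball x (r i)) x <= (2 * b * qm i.+1)%:E.
  have bq : (2 * b * qm i.+1)%:E <= (2 * b * c0)%:E.
    by rewrite lee_fin ler_wpM2l// mulr_ge0// ltW.
  move=> [[j [ji mj Kj]]|Ki]; [left; exists j; split => //|right].
  - by rewrite !mE -EFinM lee_fin.
  - by apply: le_trans Kj _; rewrite leeD2l.
  - exact: le_trans Ki bq.
have qS j : (2 * b * m j < m j.+1)%R -> (2 * qm j <= qm j.+1)%R.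
  move=> mj; rewrite /qm rS ler_pdivlMr; last exact: mulr_gt0 b0 (r0 j).
  rewrite (_ : 2 * (m j / r j) * (b * r j) = 2 * b * m j)%R ?ltW//.
  by field; rewrite gt_eqF.
have bqm0 j : (0 <= 2 * b * qm j)%R.
  by apply: mulr_ge0; [rewrite mulr_ge0// ltW|exact: qm_ge0].
elim: i => [|i ih].
  have [m1|/qS q1] := leP (m 1%N) (2 * b * m 0%N)%R; [left|right].
    by exists 0%N; split => //; rewrite leeDl// lee_fin.
  apply: le_trans pk_ball0 _; rewrite lee_fin.
  have : (qm 1%N <= b * qm 1%N)%R by rewrite ler_peMl.
  by have := qm_ge0 0%N; lra.
have [m1|/qS q1] := leP (m i.+2) (2 * b * m i.+1)%R.
  by left; exists i.+1; split => //; rewrite leeDl// lee_fin.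
have q2 : (2 * b * qm i.+1 + b * qm i.+1 <= 2 * b * qm i.+2)%R.
  have : (b * (2 * qm i.+1) <= b * qm i.+2)%R by rewrite ler_wpM2l// ltW.
  have : (0 <= b * qm i.+1)%R by apply: mulr_ge0; [exact: ltW|exact: qm_ge0].
  lra.
case: ih => [[j [ji mj Kj]]|Ki]; [left; exists j; split => //|right].
- exact: leqW.
- apply: le_trans (pk_ballS i) _.
  apply: (@le_trans _ _ (pk (qball x (r j)) x + (2 * b * qm i.+1)%:E +
    (b * qm i.+1)%:E)).
    by rewrite leeD2r.
  by rewrite -addeA leeD2l// -EFinD lee_fin.
- apply: le_trans (pk_ballS i) _.
  apply: (@le_trans _ _ ((2 * b * qm i.+1)%:E + (b * qm i.+1)%:E)).
    by rewrite leeD2r.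
  by rewrite -EFinD lee_fin.
Qed.

End scales.

(** The ratio of consecutive radii, at least the engulfing constant
    [kappa + kappa ^+ 2 + 2 * kappa ^+ 3]. *)
Let b : R := (4 * kappa ^+ 3)%R.
(** Of a potential above [A * t], the far part takes at most [kappa * (b + 1) * t], which leaves
    more than [2 * t] for the near part. *)
Let A : R := (kappa * (b + 1) + 2)%R.

Let b4 : (4 <= b)%R.
Proof.
have : (1 <= kappa ^+ 3)%R by rewrite exprn_ege1.
rewrite /b; lra.
Qed.

Let b1 : (1 <= b)%R. Proof. by have := b4; lra. Qed.
Let b0 : (0 < b)%R. Proof. exact: lt_le_trans b1. Qed.

Let kb : (kappa + kappa ^+ 2 + 2 * kappa ^+ 3 <= b)%R.
Proof.
have k2 : (1 <= kappa ^+ 2)%R by rewrite exprn_ege1.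
have : (kappa <= kappa ^+ 3)%R by rewrite [leRHS]exprS ler_peMr// ltW.
have : (kappa ^+ 2 <= kappa ^+ 3)%R by rewrite [leRHS]exprS ler_peMl// sqr_ge0.
rewrite /b; lra.
Qed.

Let A1 : (1 <= A)%R.
Proof. by rewrite /A ler_wpDl// ?ler1n// mulr_ge0 ?addr_ge0 ?(ltW b0) ?ltW. Qed.

(** Pass from [z] to [y] through the common point [p] and then [x]. A selected ball dilated by [b]
    thus contains the [2 * kappa] dilates of the discarded balls that it meets. *)
Lemma qball_engulf x z y (r s : R) : (0 < r)%R -> (r <= s)%R ->
  qball x r `&` qball z s !=set0 ->
  qball x (2 * kappa * r) y -> qball z (b * s) y.
Proof.
move=> r0 rs [p [/= xp zp]] xy; rewrite /qball/= in xp zp xy *.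
have s0 : (0 < s)%R by exact: lt_le_trans rs.
have py : (D p y <= kappa * (s + 2 * kappa * s))%R.
  apply: (le_trans (Dtri p y x)); rewrite ler_wpM2l ?(ltW kappa0)//.
  rewrite lerD//; first by rewrite Dsym (le_trans (ltW xp)).
  by apply: (le_trans (ltW xy)); rewrite ler_wpM2l// mulr_ge0// ltW.
apply: (le_lt_trans (Dtri z y p)).
apply: (@lt_le_trans _ _ (kappa * (s + kappa * (s + 2 * kappa * s)))%R).
  by rewrite (ltr_pM2l kappa0); exact: ltr_leD.
have -> : (kappa * (s + kappa * (s + 2 * kappa * s)) =
    (kappa + kappa ^+ 2 + 2 * kappa ^+ 3) * s)%R by ring.
by rewrite ler_wpM2r// ltW.
Qed.

(** * The good-lambda inequality for potentials of a set of finite measure *)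

Section good_lambda.
Variable E : set T.
Hypotheses (mE : measurable (E : set (borel T))) (Eoo : sigma E < +oo).

Let r j : R := (delta * b ^+ j)%R.
Let r0 j : (0 < r j)%R. Proof. by rewrite mulr_gt0// exprn_gt0. Qed.
Let rS j : r j.+1 = (b * r j)%R. Proof. by rewrite /r exprS mulrCA. Qed.

Let level (t : R) : set T := [set x | t%:E < pk E x].

(** At a scale [i] whose ball lies in the level set while the far part stays below
    [kappa * (b + 1) * t], the near part exceeds [2 * t]. Passing to a doubling scale loses at most
    [2 * b * c0 <= t]. *)
Let scale_exists (t : R) x : (2 * b * c0 <= t)%R -> level (A * t) x ->
  exists j, [/\ qball x (r j) `<=` level t,
    sigma (qball x (r j.+1)) <= (2 * b)%:E * sigma (qball x (r j)) &
    t%:E < pk (qball x (r j)) x].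
Proof.
move=> tc ux.
have c2 : (c0 <= 2 * b * c0)%R by rewrite ler_peMl ?(ltW c0_gt0)//;
  have := b1; lra.
have t0 : (0 < t)%R by apply: lt_le_trans tc; rewrite !mulr_gt0.
have kb1 : (0 <= kappa * (b +
  1))%R by rewrite mulr_ge0 ?addr_ge0 ?(ltW b0) ?ltW.
have split_pk j : pk E x <= pk (qball x (r j)) x + pk (E `\` qball x (r j)) x.
  have -> : pk E x = pk (E `&` qball x (r j)) x + pk (E `\` qball x (r j)) x.
    rewrite -[in LHS](setUIDK E (qball x (r j))) /trunc_potential
      ge0_integral_setU//.
    - exact: measurableI.
    - exact: measurableD.
    - by rewrite setUIDK; exact: measurable_funTS.
    - by apply/disj_setPS => y [[_ ?] []].
  by rewrite leeD2r//; apply: pkS => //; exact: measurableI.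
have far_ext j x' : ~ level t x' -> (D x x' < b * r j)%R ->
    pk (E `\` qball x (r j)) x <= (kappa * (b + 1) * t)%:E.
  move=> /negP; rewrite -leNgt => ux' Dxx'.
  apply: le_trans (far_potential_le mE (r0 j) b0 Dxx') _.
  by rewrite [leRHS]EFinM lee_wpmul2l.
have [i [Pi fari]] : exists i, qball x (r i) `<=` level t /\
    pk (E `\` qball x (r i)) x <= (kappa * (b + 1) * t)%:E.
  (* At a scale this large the far part is at most [sigma E / r J <= t], whether or not the ball
     lies in the level set. *)
  have [J sEJ] : exists J, sigma E <= (t * r J)%:E.
    pose e : R := (fine (sigma E) / (t * delta))%R.
    exists (Num.truncn e).+1;
      rewrite -(fineK (x := sigma E)) ?ge0_fin_numE// lee_fin.
    rewrite /r mulrA -ler_pdivrMl ?mulr_gt0// mulrC -/e.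
    apply: (le_trans (ltW (truncnS_gt e))).
    apply: (@le_trans _ _ (2 ^+ (Num.truncn e).+1)%R).
      by rewrite -natrX ler_nat ltnW// ltn_expl.
    by apply: lerXn2r; rewrite ?nnegrE ?(ltW b0)//; have := b4; lra.
  have farJ : pk (E `\` qball x (r J)) x <= (kappa * (b + 1) * t)%:E.
    have mEB : measurable (E `\` qball x (r J) :
      set (borel T)) by exact: measurableD.
    apply: (@le_trans _ _ (\int[sigma]_(y in E `\` qball x (r J)) ((r
      J)^-1)%:E)).
      apply: ge0_le_integralW => // y [_ /negP]; rewrite /qball/= -leNgt => rD.
      by apply: k_le => //; rewrite le_max rD.
    rewrite integral_cst//;
      apply: (@le_trans _ _ (((r J)^-1)%:E * (t * r J)%:E)).
      apply: lee_wpmul2l; first by rewrite lee_fin invr_ge0 ltW.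
      by apply: le_trans sEJ; apply: measureS => // y [].
    rewrite -EFinM lee_fin mulrCA mulVf ?gt_eqF// mulr1 ler_peMl ?(ltW t0)//.
    by rewrite mulr_ege1// lerDr ltW.
  have [PJ|] := pselect (qball x (r J) `<=` level t); first by exists J.
  (* Descend to the first ball contained in the level set; the ball one scale up has a point of
     potential at most [t], which controls the far part. If even scale 0 fails, the potential at [x]
     is at most [c0 + kappa * (b + 1) * t <= A * t], a contradiction. *)
  elim: J {sEJ farJ} => [|i ih] nP.
    have [y [By nLy]] : exists y, qball x (r 0%N) y /\ ~ level t y.
      apply: contrapT => nby; apply: nP => y By; apply: contrapT => nLy.
      by apply: nby; exists y.
    exfalso; move: ux; rewrite /level /= ltNge => /negP; apply.
    apply: le_trans (split_pk 0%N) _.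
    apply: (@le_trans _ _ (c0%:E + (kappa * (b + 1) * t)%:E)).
      apply: leeD.
        by rewrite /r expr0 mulr1; exact: trunc_potential_small_ball.
      apply: (far_ext _ y) => //; apply: (lt_le_trans By).
      by rewrite ler_peMl ?(ltW (r0 _)).
    rewrite -EFinD lee_fin /A mulrDl addrC lerD2l.
    by rewrite (le_trans (le_trans c2 tc))// ler_peMl ?(ltW t0) ?ler1n.
  have [Pi|/ih//] := pselect (qball x (r i) `<=` level t).
  exists i; split => //.
  have [y [By nLy]] : exists y, qball x (r i.+1) y /\ ~ level t y.
    apply: contrapT => nby; apply: nP => y By; apply: contrapT => nLy.
    by apply: nby; exists y.
  by apply: (far_ext _ y) => //; rewrite -rS.
have Ki : (2 * t)%:E < pk (qball x (r i)) x.
  rewrite ltNge; apply/negP => Ki; move: ux; rewrite /level /= ltNge => /negP;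
    apply.
  apply: le_trans (split_pk i) _; apply: le_trans (leeD Ki fari) _.
  by rewrite -EFinD lee_fin /A [leRHS]mulrDl [leRHS]addrC.
have [[j [ji dj Kj]]|] := potential_at_doubling_scale x b1 i.
  exists j; split => //.
    apply: subset_trans Pi => y; rewrite /qball /= => /lt_le_trans; apply.
    by rewrite ler_wpM2l ?(ltW delta0)// ler_weXn2l.
  rewrite ltNge; apply/negP => Kjt; move: Ki; rewrite ltNge => /negP; apply.
  apply: le_trans Kj _; apply: le_trans (leeD Kjt (lexx _)) _.
  by rewrite -EFinD lee_fin; have := tc; lra.
move=> Ki2; move: Ki; rewrite ltNge => /negP; case; apply: le_trans Ki2 _.
by rewrite lee_fin (le_trans tc)// ler_peMl ?ler1n// ltW.
Qed.

Lemma good_lambda_qball (t : R) : (2 * b * c0 <= t)%R ->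
  t%:E * sigma (level (A * t)) <= (2 * b * c)%:E * sigma (level t).
Proof.
move=> tc.
have t0 : (0 < t)%R by apply: lt_le_trans tc; rewrite !mulr_gt0.
rewrite -lee_pdivlMl//; apply: measure_open_le => //; first exact: pk_open.
move=> Q cQ QA; rewrite lee_pdivlMl//.
have /choice[j jP] : forall x, exists j, level (A * t) x ->
    [/\ qball x (r j) `<=` level t,
    sigma (qball x (r j.+1)) <= (2 * b)%:E * sigma (qball x (r j)) &
    t%:E < pk (qball x (r j)) x].
  move=> x; have [ux|nux] := pselect (level (A * t) x); last by exists 0%N.
  by have [j ?] := scale_exists tc ux; exists j.
(* By lower semicontinuity the potential of the ball chosen at [x] still exceeds [t] near [x]; the
   compact set [Q] is covered by finitely many such neighbourhoods. *)
pose V x := qball x (2 * kappa *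
  r (j x)) `&` [set y | t%:E < pk (qball x (r (j x))) y].
have ball_neq0 x : level (A * t) x -> qball x (r (j x)) !=set0.
  move=> /jP[_ _ tx]; apply/set0P/eqP => B0; move: tx.
  by rewrite B0 /trunc_potential integral_set0 lte_fin ltNge (ltW t0).
have [x Qx|s [sQ QV]] := compact_cover_seq (U := V) cQ.
  split; first by apply: openI => //; exact: pk_open.
  have [_ _ tx] := jP x (QA _ Qx); split => //=.
  (* [D x x] need not vanish, so a ball may miss its centre; a point of the ball gives
     [D x x <= 2 * kappa * D x y], and the dilated ball contains the centre. *)
  have [y xy] := ball_neq0 x (QA _ Qx); rewrite /qball/= in xy *.
  apply: (le_lt_trans (Dtri x x y)); rewrite (Dsym y x).
  have -> : (2 * kappa * r (j x) = kappa * (r (j x) + r (j x)))%R by ring.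
  by rewrite (ltr_pM2l kappa0) ltrD.
have [s' [s's ps' cs']] := finite_vitali (fun x => qball x (r (j x))) j s.
pose H z := qball z (r (j z).+1) `&` [set y | t%:E < pk (qball z (r (j z).+1))
  y].
have mH z : measurable (H z : set (borel T)).
  by apply: measurableI => //; apply: borel_open; exact: pk_open.
have QH : Q `<=` \big[setU/set0]_(z <- s') H z.
  move=> y /QV[x xs [xy ty]].
  have [z zs' [jxz Bxz]] := cs' x xs (ball_neq0 x (QA _ (sQ _ xs))).
  rewrite -bigcup_seq; exists z => //=.
  have rxz : (r (j x) <= r (j z))%R by rewrite ler_wpM2l ?(ltW delta0)//
    ler_weXn2l.
  have eng w := @qball_engulf x z w _ _ (r0 _) rxz Bxz.
  split; first by rewrite rS; exact: eng.
  apply: (lt_le_trans ty); apply: pkS => // w xw; rewrite rS; apply: eng.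
  apply: (lt_le_trans xw); rewrite ler_peMl ?(ltW (r0 _))//; have := kappa1;
    lra.
(* Markov's inequality and the testing condition on the larger ball, then doubling to return to the
   selected ball; hence the constant [2 * b * c]. *)
have tH z : z \in s' ->
  t%:E * sigma (H z) <= (2 * b * c)%:E * sigma (qball z (r (j z))).
  move=> zs'; have [_ dz _] := jP z (QA _ (sQ _ (s's _ zs'))).
  apply: (@le_trans _ _ (c%:E * sigma (qball z (r (j z).+1)))).
    apply: le_trans (test z (r0 _)).
    apply: markov_ge0; [exact: mB|exact: mH|by apply: measurable_funTS;
      exact: mpk| | |exact: ltW|].
    - by move=> y _; exact: pk0.
    - by move=> y [].
    - by move=> y [_ /ltW].
  rewrite mulrC EFinM -muleA; apply: lee_wpmul2l => //; rewrite lee_fin ltW//.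
apply: (@le_trans _ _ (\sum_(z <- s') (t%:E * sigma (H z)))).
  rewrite -ge0_sume_distrr//; apply: lee_wpmul2l; first by rewrite lee_fin ltW.
  apply: (@le_trans _ _ (sigma (\big[setU/set0]_(z <- s') H z))).
    by apply: measureS => //; [exact: borel_compact|exact: bigsetU_measurable].
  elim: (s') => [|z s0 ih]; first by rewrite !big_nil measure0.
  rewrite !big_cons; apply: le_trans (measureU2 _ _ _) _ => //.
    exact: bigsetU_measurable.
  by rewrite leeD2l.
apply: (@le_trans _ _ (\sum_(z <- s') ((2 * b * c)%:E *
  sigma (qball z (r (j z)))))).
  by rewrite big_seq [leRHS]big_seq; apply: lee_sum => z; exact: tH.
rewrite -ge0_sume_distrr//; apply: lee_wpmul2l.
  by rewrite lee_fin !mulr_ge0// ltW.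
rewrite measure_pairwise_disjoint//; apply: measureS.
- exact: bigsetU_measurable.
- by apply: borel_open; exact: pk_open.
- rewrite -bigcup_seq => y [z /= zs' zy].
  by have [+ _ _] := jP z (QA _ (sQ _ (s's _ zs'))); apply.
Qed.

Let A0 : (0 < A)%R. Proof. exact: lt_le_trans A1. Qed.

Let mlevel t : measurable (level t : set (borel T)).
Proof. by apply: borel_open; exact: pk_open. Qed.

(** Between [s] and [A * s] the potential contributes at most [A * s] times the measure of the
    level. The remaining part, by induction and the good-lambda inequality, contributes no more than
    that because [4 * A * b * c <= s]. The induction stops since the potential is bounded. *)
Lemma high_level_integral n (s : R) : (2 * b * c0 <= s)%R ->
  (4 * A * b * c <= s)%R ->
  (forall x, pk E x <= (A ^+ n * s)%:E) ->
  \int[sigma]_(x in level s) pk E x <= (2 * A * s)%:E * sigma (level s).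
Proof.
elim: n s => [|n ih] s sc0 sc ub.
  rewrite (_ : level s = set0) ?integral_set0 ?measure0 ?mule0//.
  apply/seteqP; split => // x; rewrite /level /= ltNge => /negP; case.
  by have := ub x; rewrite expr0 mul1r.
have s0 : (0 < s)%R by apply: lt_le_trans sc0; rewrite !mulr_gt0.
have sAs : (s <= A * s)%R by rewrite ler_peMl// ltW.
have lAs : level (A * s) `<=` level s.
  by move=> x; rewrite /level /=; apply: le_lt_trans; rewrite lee_fin.
rewrite -{1}(setDUK lAs) ge0_integral_setU//; last 3 first.
- exact: measurableD.
- by apply: measurable_funTS; exact: mpk.
- by apply/disj_setPS => y [? []].
apply: (@le_trans _ _ ((A * s)%:E * sigma (level s) +
  (A * s)%:E * sigma (level s))); last first.
  rewrite -ge0_muleDl ?lee_fin ?mulr_ge0 ?(ltW A0) ?(ltW s0)//.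
  by rewrite -EFinD (_ : A * s + A * s = 2 * A * s)%R//; ring.
rewrite addeC; apply: leeD.
  apply: (@le_trans _ _ (\int[sigma]_(x in level s `\` level (A * s)) ((A *
    s)%:E))).
    apply: ge0_le_integralW => x; first by move=> _; exact: pk0.
    by move=> [_ /negP]; rewrite /level /= -leNgt.
  rewrite integral_cst; last exact: measurableD.
  apply: lee_wpmul2l; first by rewrite lee_fin mulr_ge0 ?(ltW A0) ?(ltW s0).
  by apply: measureS => //; exact: measurableD.
apply: le_trans (ih (A * s)%R _ _ _) _.
- exact: le_trans sAs.
- exact: le_trans sAs.
- by move=> x; rewrite mulrA -exprSr.
apply: (@le_trans _ _ ((2 * A ^+ 2)%:E * (s%:E * sigma (level (A * s))))).
  by rewrite muleA -EFinM (_ : 2 * A * (A * s) = 2 * A ^+ 2 * s)%R//; ring.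
apply: (@le_trans _ _ ((2 * A ^+ 2)%:E * ((2 * b * c)%:E * sigma (level s)))).
  apply: lee_wpmul2l; first by rewrite lee_fin mulr_ge0// exprn_ge0// ltW.
  exact: good_lambda_qball.
rewrite muleA -EFinM; apply: lee_wpmul2r => //; rewrite lee_fin.
rewrite (_ : 2 * A ^+ 2 * (2 * b * c) = A * (4 * A * b * c))%R; last by ring.
by rewrite ler_wpM2l// ltW.
Qed.

Lemma trunc_potential_le_mass x : pk E x <= (delta^-1)%:E * sigma E.
Proof.
rewrite -integral_cst//; apply: ge0_le_integralW => // y _; apply: k_le => //.
by rewrite le_max lexx orbT.
Qed.

End good_lambda.

Let A0 : (0 < A)%R. Proof. exact: lt_le_trans A1. Qed.

(** The first summand is for the good-lambda inequality, the second for summing over high levels,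
    the third for absorbing the energy constant in [energy_step]. *)
Definition level_threshold : R :=
  (2 * b * c0 + 4 * A * b * c + 192 * A ^+ 2 * b * c * kappa ^+ 2)%R.
Local Notation S0 := level_threshold.

Let S0_ge : [/\ (2 * b * c0 <= S0)%R, (4 * A * b * c <= S0)%R &
  (192 * A ^+ 2 * b * c * kappa ^+ 2 <= S0)%R].
Proof.
have h1 : (0 < 2 * b * c0)%R by rewrite !mulr_gt0.
have h2 : (0 < 4 * A * b * c)%R by rewrite !mulr_gt0.
have h3 : (0 < 192 * A ^+ 2 * b * c * kappa ^+ 2)%R.
  by rewrite !mulr_gt0 ?exprn_gt0.
by rewrite /S0; split; lra.
Qed.

Let S0_gt0 : (0 < S0)%R.
Proof. by have [h _ _] := S0_ge; apply: lt_le_trans h; rewrite !mulr_gt0. Qed.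

Let mass_le E x0 (r : R) : (0 < r)%R -> measurable (E : set (borel T)) ->
  E `<=` qball x0 r -> sigma E <= (c0 * r)%:E.
Proof.
move=> r0 mE Er; apply: le_trans (growth x0 r0); exact: measureS.
Qed.

(** Below [A * S0] the potential is bounded directly. Above it, the high levels are controlled by
    the measure of [level S0], which the weak bound estimates through [N]; the size of [S0] then
    reduces [N] by the factor [4 * kappa]. *)
Lemma energy_step (x0 : T) (r N : R) : (0 < r)%R -> (0 < N)%R ->
  (forall F : set T, measurable (F : set (borel T)) ->
     F `<=` qball x0 (2 * kappa * r) ->
     \int[sigma]_(x in F) pk F x <= N%:E * sigma F) ->
  forall E : set T, measurable (E : set (borel T)) -> E `<=` qball x0 r ->
    \int[sigma]_(x in E) pk E x <= (A * S0 + N / (4 * kappa))%:E * sigma E.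
Proof.
move=> r0 N0 HN E mE Er; have [S1 S2 S3] := S0_ge.
have sEr := mass_le r0 mE Er.
have Eoo : sigma E < +oo by apply: le_lt_trans sEr (ltry _).
pose level (t : R) : set T := [set x | t%:E < pk E x].
have mlevel t : measurable (level t : set (borel T)).
  by apply: borel_open; exact: pk_open.
have c0S : (c0 <= S0)%R.
  by apply: le_trans S1; rewrite ler_peMl ?(ltW c0_gt0)//; have := b1; lra.
(* A point outside the larger ball is at distance at least [r] from [E], so its potential is at most
   [sigma E / r <= c0 <= S0]. *)
have levelr : level S0 `<=` qball x0 (2 * kappa * r).
  move=> x; rewrite /level /qball /=; apply: contraTT; rewrite -!leNgt => rx.
  apply: (@le_trans _ _ (\int[sigma]_(y in E) (r^-1)%:E)).
    apply: ge0_le_integralW => // y /Er; rewrite /qball /= => x0y.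
    apply: k_le => //; rewrite le_max; apply/orP; left.
    have := Dtri x0 x y; rewrite (Dsym y x) => tri.
    have : (kappa * (r + r) <= kappa * (r + D x y))%R.
      rewrite (_ : kappa * (r + r) = 2 * kappa * r)%R; last by ring.
      by apply: (le_trans rx); apply: (le_trans tri);
        rewrite ler_wpM2l ?(ltW kappa0)// lerD2r ltW.
    by rewrite ler_pM2l// lerD2l.
  rewrite integral_cst//; apply: (@le_trans _ _ ((r^-1)%:E * (c0 * r)%:E)).
    by apply: lee_wpmul2l => //; rewrite lee_fin invr_ge0 ltW.
  by rewrite -EFinM lee_fin mulrCA mulVf ?gt_eqF// mulr1.
(* The capacity estimate is applied to [sigma] restricted to [E]: the kernel is symmetric, the
   potential is at most [2 * N] on the good half, and the maximum principle costs [3 * kappa]. *)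
have weakS : S0%:E * sigma (level S0) <= (12 * kappa * N)%:E * sigma E.
  rewrite -lee_pdivlMl//; apply: measure_open_le => //; first exact: pk_open.
  move=> Q cQ QS; rewrite lee_pdivlMl//.
  have mQ : measurable (Q : set (borel T)) by exact: borel_compact.
  have m1 : measurable_fun [set: borel T] (\1_E : borel T ->
    R) by exact: measurable_indic.
  have i0 x : (0 <= (\1_E : borel T -> R) x)%R by [].
  have nuT : mdensity sigma i0 m1 [set: borel T] = sigma E.
    by rewrite /mdensity integral_indic// setIT.
  have nuS : sigma_finite [set: borel T] (mdensity sigma i0 m1).
    exists (fun=> setT); first by rewrite bigcup_const.
    by move=> _; split => //; rewrite nuT.
  have mkk : measurable_fun [set: borel T * borel T] (fun z => k z.1 z.2).
    exact: lsc_prod_measurable.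
  rewrite -nuT (_ : 12 * kappa * N = 2 * 1 * (3 * kappa * (2 * N)))%R;
    last by ring.
  apply: (@weak_type_of_energy _ _ _ sigma _ k k0 mkk
    (locally_finite_sigma_finite scT lcT hT sigma_lf) nuS Q 1%R N (3 *
      kappa * (2 * N))%R S0
    mQ (compact_finite_measure hT sigma_lf cQ) ltr01 N0).
  - by rewrite !mulr_ge0 ?(ltW N0) ?(ltW kappa0).
  - exact: ltW.
  - by move=> x y; rewrite mul1e /trunc_kernel Dsym.
  - by apply: HN => //; exact: subset_trans levelr.
  - set F := [set y | _ /\ _] => x.
    have mF : measurable (F : set (borel T)).
      rewrite (_ : F = Q `&` (fun x =>
        pk Q x) @^-1` [set z | z <= (2 * N)%:E])//.
      by apply: emeasurable_fun_infty_c => //; apply: measurable_funTS;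
        exact: mpk.
    apply: trunc_max_principle => //; first by rewrite mulr_ge0// ltW.
    move=> y [Qy Fy]; apply: le_trans Fy; apply: pkS => //.
    by move=> z [].
  - move=> x /QS /ltW; rewrite integral_mdensity// => /le_trans; apply.
    rewrite /trunc_potential [leLHS]integral_mkcond;
      apply: ge0_le_integralW => y _.
      exact: erestrict_ge0.
    by rewrite patchE indicE; case: ifPn => _; rewrite ?mule1 ?mule0.
have [n ub] : exists n, forall x, pk E x <= (A ^+ n * (A * S0))%:E.
  pose e : R := (delta^-1 * (c0 * r) / (A * S0))%R.
  exists (Num.truncn e).+1 => x.
  apply: le_trans (trunc_potential_le_mass mE x) _.
  apply: (@le_trans _ _ ((delta^-1)%:E * (c0 * r)%:E)).
    by apply: lee_wpmul2l => //; rewrite lee_fin invr_ge0 ltW.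
  rewrite -EFinM lee_fin -ler_pdivrMr ?mulr_gt0// -/e.
  apply: (le_trans (ltW (truncnS_gt e))).
  apply: (@le_trans _ _ (2 ^+ (Num.truncn e).+1)%R).
    by rewrite -natrX ler_nat ltnW// ltn_expl.
  apply: lerXn2r; rewrite ?nnegrE ?(ltW A0)// /A lerDr mulr_ge0 ?(ltW kappa0)//.
  by rewrite addr_ge0 ?(ltW b0).
have SAS : (S0 <= A * S0)%R by rewrite ler_peMl// ltW.
(* The constants multiply to [48 * A ^+ 2 * b * c * kappa * N / S0], which is at most
   [N / (4 * kappa)] by the third summand of [S0]. *)
have high : \int[sigma]_(x in level (A * S0)%R) pk E x <=
    (N / (4 * kappa))%:E * sigma E.
  apply: le_trans (high_level_integral mE Eoo _ _ ub) _.
  - exact: le_trans SAS.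
  - exact: le_trans SAS.
  apply: (@le_trans _ _ ((2 * A ^+ 2)%:E * (S0%:E * sigma (level (A * S0)%R)))).
    by rewrite muleA -EFinM (_ : 2 * A * (A * S0) = 2 * A ^+ 2 * S0)%R//; ring.
  apply: (@le_trans _ _ ((2 * A ^+ 2)%:E * ((2 * b * c)%:E *
    sigma (level S0)))).
    apply: lee_wpmul2l; first by rewrite lee_fin mulr_ge0// sqr_ge0.
    exact: good_lambda_qball.
  apply: (@le_trans _ _ ((4 * A ^+ 2 * b * c * S0^-1)%:E * (S0%:E *
    sigma (level S0)))).
    rewrite !muleA -!EFinM (_ :
      4 * A ^+ 2 * b * c * S0^-1 * S0 = 2 * A ^+ 2 * (2 * b * c))%R//.
    by field; rewrite gt_eqF.
  apply: (@le_trans _ _ ((4 * A ^+ 2 * b * c * S0^-1)%:E * ((12 * kappa *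
    N)%:E * sigma E))).
    apply: lee_wpmul2l => //; rewrite lee_fin; apply: ltW.
    by rewrite !mulr_gt0 ?invr_gt0 ?exprn_gt0.
  rewrite muleA -EFinM; apply: lee_wpmul2r => //; rewrite lee_fin.
  rewrite ler_pdivlMr ?mulr_gt0//.
  rewrite (_ : _ * (4 * kappa) = (192 * A ^+ 2 * b * c * kappa ^+ 2) / S0 *
    N)%R; last first.
    by field; rewrite gt_eqF.
  by rewrite ler_piMl ?(ltW N0)// ler_pdivrMr// mul1r.
rewrite EFinD ge0_muleDl; last 2 first.
- by rewrite lee_fin mulr_ge0 ?(ltW A0) ?(ltW S0_gt0).
- by rewrite lee_fin divr_ge0 ?(ltW N0)// mulr_ge0// ltW.
rewrite -{1}(setUIDK E (level (A * S0)%R)) ge0_integral_setU//; last 4 first.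
- exact: measurableI.
- exact: measurableD.
- by apply: measurable_funTS; exact: mpk.
- by apply/disj_setPS => y [[_ ?] []].
rewrite addeC; apply: leeD.
  apply: (@le_trans _ _ (\int[sigma]_(x in E `\` level (A * S0)%R) ((A *
    S0)%:E))).
    apply: ge0_le_integralW => x; first by move=> _; exact: pk0.
    by move=> [_ /negP]; rewrite /level /= -leNgt.
  rewrite integral_cst; last exact: measurableD.
  apply: lee_wpmul2l; first by rewrite lee_fin mulr_ge0 ?(ltW A0) ?(ltW S0_gt0).
  by apply: measureS => //; exact: measurableD.
apply: le_trans high; apply: ge0_subset_integral => //.
- exact: measurableI.
- by apply: measurable_funTS; exact: mpk.
Qed.

(** The crude bound [c0 * r / delta] starts the induction. Each step enlarges the radius by
    [2 * kappa] but divides the constant by [4 * kappa], a net gain of one half, while [2 * A * S0]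
    reproduces itself. *)
Lemma energy_iterate n (x0 : T) (r : R) (E : set T) : (0 < r)%R ->
  measurable (E : set (borel T)) -> E `<=` qball x0 r ->
  \int[sigma]_(x in E) pk E x <=
    (2 * A * S0 + c0 * r / delta / 2 ^+ n)%:E * sigma E.
Proof.
elim: n r E => [|n ih] r E r0 mE Er.
  apply: (@le_trans _ _ (\int[sigma]_(x in E) (c0 * r / delta)%:E)).
    apply: ge0_le_integralW => x _; first exact: pk0.
    apply: le_trans (trunc_potential_le_mass mE x) _.
    rewrite mulrC EFinM; apply: lee_wpmul2l;
      first by rewrite lee_fin invr_ge0 ltW.
    exact: mass_le Er.
  rewrite integral_cst//; apply: lee_wpmul2r => //; rewrite lee_fin expr0 divr1.
  by rewrite lerDr !mulr_ge0 ?(ltW A0) ?(ltW S0_gt0).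
have k2r : (0 < 2 * kappa * r)%R by rewrite !mulr_gt0.
have N0 : (0 < 2 * A * S0 + c0 * (2 * kappa * r) / delta / 2 ^+ n)%R.
  by rewrite addr_gt0 ?divr_gt0 ?mulr_gt0 ?exprn_gt0.
apply: le_trans (energy_step r0 N0 _ mE Er) _.
  by move=> F mF Fr; exact: ih.
apply: lee_wpmul2r => //; rewrite lee_fin.
have -> : ((2 * A * S0 + c0 * (2 * kappa * r) / delta / 2 ^+ n) / (4 * kappa) =
    A * S0 / (2 * kappa) + c0 * r / delta / 2 ^+ n.+1)%R.
  rewrite exprS; field; rewrite !gt_eqF// exprn_gt0//.
rewrite addrA lerD2r.
have : (A * S0 / (2 * kappa) <= A * S0)%R.
  rewrite ler_pdivrMr ?mulr_gt0// ler_peMr ?mulr_ge0 ?(ltW A0) ?(ltW S0_gt0)//.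
  by have := kappa1; lra.
lra.
Qed.

Definition energy_constant : R := (2 * A * S0 + 1)%R.

Lemma energy_constant_gt0 : (0 < energy_constant)%R.
Proof. by rewrite ltr_wpDl// !mulr_ge0 ?(ltW A0) ?(ltW S0_gt0). Qed.

(** Iterate until the power of 2 exceeds [c0 * r / delta]; the resulting constant depends on neither
    [delta] nor [r]. *)
Lemma trunc_energy_le (x0 : T) (r : R) (E : set T) : (0 < r)%R ->
  measurable (E : set (borel T)) -> E `<=` qball x0 r ->
  \int[sigma]_(x in E) pk E x <= energy_constant%:E * sigma E.
Proof.
move=> r0 mE Er; pose e : R := (c0 * r / delta)%R.
apply: le_trans (energy_iterate (Num.truncn e).+1 r0 mE Er) _.
apply: lee_wpmul2r => //; rewrite lee_fin lerD2l -/e.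
rewrite ler_pdivrMr ?exprn_gt0// mul1r.
apply: (le_trans (ltW (truncnS_gt e))).
by rewrite -natrX ler_nat ltnW// ltn_expl.
Qed.

End quasi_metric.

(** * Quasi-metric kernels *)

Section quasi_metric_kernels.
Context {T : ptopologicalType} {R : realType}.
Variable sigma : {measure set (borel T) -> \bar R}.
Variable G : T -> T -> \bar R.
Hypotheses (lcT : locally_compact [set: T]) (hT : hausdorff_space T)
  (scT : @second_countable T) (sigma_lf : locally_finite sigma)
  (G0 : forall x y : T, 0 <= G x y)
  (Glsc : lower_semicontinuous (fun z : T * T => G z.1 z.2)).
Variable kappa0 : R.
Hypothesis Gqm : quasi_metric_kernel G kappa0.

Let D x y : R := fine (kernel_dist G x y).
(** Raising the constant to at least 1 preserves the quasi-triangle inequality. *)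
Let kappa : R := Num.max kappa0 1%R.

Let kappa1 : (1 <= kappa)%R. Proof. by rewrite le_max lexx orbT. Qed.
Let kappa_gt0 : (0 < kappa)%R. Proof. exact: lt_le_trans kappa1. Qed.

Let DE x y : kernel_dist G x y = (D x y)%:E.
Proof. by rewrite fineK// ge0_fin_numE; have [_ /(_ x y) /andP[]] := Gqm. Qed.

Let GE x y : G x y = (D x y)%:E^-1.
Proof. by rewrite -DE /kernel_dist inveK. Qed.

Let D0 x y : (0 <= D x y)%R.
Proof. by rewrite -lee_fin -DE; have [_ /(_ x y) /andP[]] := Gqm. Qed.

Let Gsym x y : G x y = G y x. Proof. by have [] := Gqm. Qed.

Let Dsym x y : D x y = D y x.
Proof. by rewrite /D /kernel_dist Gsym. Qed.

Let Dtri x y z : (D x y <= kappa * (D x z + D z y))%R.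
Proof.
have [_ _ _ /(_ x y z)] := Gqm; rewrite !DE -EFinD -EFinM lee_fin.
by move=> /le_trans; apply; rewrite ler_wpM2r ?addr_ge0// le_max lexx.
Qed.

Let ballE x (r : R) : quasi_metric_ball G x r = qball D x r.
Proof. by apply/seteqP; split => y;
  rewrite /quasi_metric_ball/= DE lte_fin. Qed.

Lemma quasi_metric_ball_open x (r : R) : open (quasi_metric_ball G x r).
Proof.
have [r0|r0] := ltP 0%R r; last first.
  rewrite (_ : quasi_metric_ball _ _ _ = set0); first exact: open0.
  by apply/seteqP; split => // y; rewrite ballE /qball/= ltNge (le_trans r0).
rewrite (_ : quasi_metric_ball _ _ _ = [set y : T | (r^-1)%:E < G x y]).
  exact: (lower_semicontinuousP _).1 (@lsc_sectionl _ _ _ Glsc x) _.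
apply/seteqP; split => y; rewrite /quasi_metric_ball /kernel_dist/=.
  by rewrite inve_plt ?inver ?gt_eqF// inE// lee_fin ltW.
by rewrite inve_plt ?inver ?gt_eqF// inE// lee_fin ltW.
Qed.

Let oB x r : open (qball D x r).
Proof. by rewrite -ballE; exact: quasi_metric_ball_open. Qed.

Let trunc_kernelE (delta : R) x y : (0 < delta)%R ->
  trunc_kernel D delta x y = Order.min (G x y) (delta^-1)%:E.
Proof.
move=> d0; rewrite /trunc_kernel GE; have [Dd|dD] := leP (D x y) delta.
  have -> : (delta^-1)%:E = delta%:E^-1 by rewrite inver gt_eqF.
  rewrite min_r//.
  by rewrite lee_pV2// inE/= lee_fin// ltW.
have Dxy0 : (0 < D x y)%R by exact: lt_trans dD.
rewrite inver gt_eqF// min_l// lee_fin lef_pV2 ?posrE//; exact: ltW.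
Qed.

Let klsc (delta : R) : (0 < delta)%R ->
  lower_semicontinuous (fun z : T * T => trunc_kernel D delta z.1 z.2).
Proof.
move=> d0 z a; rewrite trunc_kernelE// lt_min => /andP[az ad].
have [V Vz Va] := Glsc az; exists V => // y Vy.
by rewrite trunc_kernelE// lt_min ad andbT; exact: Va.
Qed.

(** Two points of the ball are at distance at most [2 * kappa * r], so the energy of [A] is at least
    the square of its measure divided by that; finiteness of [sigma A] allows cancelling one
    factor. *)
Lemma growth_of_energy (z : T) (r c : R) (A : set T) : (0 < r)%R -> (0 < c)%R ->
  measurable (A : set (borel T)) -> A `<=` quasi_metric_ball G z r ->
  sigma A < +oo -> energy G sigma A <= c%:E * sigma A ->
  sigma A <= (2 * kappa * c * r)%:E.
Proof.
move=> r0 c0 mA Ar Aoo EA.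
have kr0 : (0 < 2 * kappa * r)%R by rewrite !mulr_gt0.
have Gge x y : A x -> A y -> ((2 * kappa * r)^-1)%:E <= G x y.
  move=> /Ar; rewrite ballE /qball/= => zx /Ar; rewrite ballE /qball/= => zy.
  rewrite GE -[X in X <= _]inveK lee_pV2 ?inE/= ?lee_fin ?inve_ge0 ?lee_fin
    ?invr_ge0 ?(ltW kr0)//.
  rewrite inver invr_eq0 gt_eqF// invrK lee_fin (le_trans (Dtri x y z))//.
  rewrite (_ : 2 * kappa * r = kappa * (r + r))%R; last by ring.
  by rewrite ler_wpM2l ?(ltW kappa_gt0)// lerD// ?(Dsym x z) ltW.
have : ((2 * kappa * r)^-1)%:E * sigma A * sigma A <= c%:E * sigma A.
  apply: le_trans EA; rewrite -[leLHS]integral_cst//.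
  apply: ge0_le_integralW => y Ay.
    by rewrite mule_ge0// lee_fin invr_ge0 ltW.
  rewrite -integral_cst//; apply: ge0_le_integralW => x Ax.
    by rewrite lee_fin invr_ge0 ltW.
  exact: Gge.
have sfin : sigma A \is a fin_num by rewrite ge0_fin_numE.
rewrite -(fineK sfin) -!EFinM !lee_fin; set s := fine _ => ss.
have : (0 <= s)%R by exact: fine_ge0.
rewrite le_eqVlt => /predU1P[<-|s0].
  by rewrite !mulr_ge0// ltW.
move: ss; rewrite ler_pM2r// mulrC ler_pdivrMr// => /le_trans; apply.
by rewrite le_eqVlt; apply/orP; left; apply/eqP; ring.
Qed.

(** The growth bound is uniform over compact subsets of a ball, so inner regularity makes the ball
    itself of finite measure; the energy hypothesis then applies to it. *)
Lemma energy_bound_finite_on_balls (c : R) : (0 < c)%R ->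
  (forall A : set (borel T), measurable A -> sigma A < +oo ->
    energy G sigma A <= c%:E * sigma A) ->
  finite_on_balls G sigma /\ energy_bound_on_balls G sigma.
Proof.
move=> c0 cE.
have fin : finite_on_balls G sigma.
  move=> x r r0; apply: (@le_lt_trans _ _ (2 * kappa * c * r)%:E);
    last exact: ltry.
  apply: measure_open_le => //; first exact: quasi_metric_ball_open.
  move=> K cK Kr; have mK : measurable (K :
    set (borel T)) by exact: borel_compact.
  have Koo : sigma K < +oo by exact: compact_finite_measure.
  by apply: (growth_of_energy r0 c0 mK Kr Koo); exact: cE.
split => //; exists c => // x r r0; apply: cE; last exact: fin.
by apply: borel_open; exact: quasi_metric_ball_open.
Qed.

Lemma bounded_compact (x0 : T) (K : set T) : compact K ->
  exists2 r : R, (0 < r)%R & K `<=` qball D x0 r.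
Proof.
move=> cK.
have [x Kx|s [_ sK]] := compact_cover_seq (U := fun x =>
  qball D x0 (D x0 x + 1)) cK.
  by split => //; rewrite /qball/= ltrDl.
have [r r0 rs] : exists2 r : R, (0 < r)%R & forall x, x \in s ->
  (D x0 x + 1 <= r)%R.
  elim: (s) => [|a s' [r r0 rs']]; first by exists 1%R.
  exists (Num.max (D x0 a + 1) r)%R; first by rewrite lt_max r0 orbT.
  move=> x; rewrite inE => /predU1P[->|/rs' xr]; first by rewrite le_max lexx.
  by rewrite le_max xr orbT.
exists r => // y /sK[x /rs xr]; rewrite /qball/= => /lt_le_trans; exact.
Qed.

(** The truncated energies of a compact set are bounded independently of the truncation. Letting
    [dl n] tend to 0, Fatou's lemma in each variable yields the bound for [G]. *)
Lemma energy_bound_balls_compacts :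
  finite_on_balls G sigma -> energy_bound_on_balls G sigma ->
  energy_bound_on_compacts G sigma.
Proof.
move=> fin [c c0 cE].
have mb x r : measurable (qball D x r : set (borel T)) by exact: borel_open.
have c1 : (0 < 2 * kappa * c)%R by rewrite !mulr_gt0.
have growth x (r : R) : (0 < r)%R ->
  sigma (qball D x r) <= (2 * kappa * c * r)%:E.
  move=> r0; rewrite -ballE; apply: (@growth_of_energy x) => //.
  - by rewrite ballE.
  - exact: fin.
  - exact: cE.
have test (delta : R) z (r : R) : (0 < delta)%R -> (0 < r)%R ->
    \int[sigma]_(x in qball D z r) trunc_potential sigma D delta (qball D z r) x
      <= c%:E * sigma (qball D z r).
  move=> d0 r0; have := cE z r r0; rewrite ballE; apply: le_trans.
  apply: ge0_le_integralW => x _; first by apply: integral_ge0 => y _;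
    rewrite trunc_kernelE// le_min G0 lee_fin invr_ge0 ltW.
  apply: ge0_le_integralW => y _;
    first by rewrite trunc_kernelE// le_min G0 lee_fin invr_ge0 ltW.
  by rewrite trunc_kernelE// Gsym ge_min lexx.
pose C := energy_constant kappa (2 * kappa * c) c.
exists C; first exact: energy_constant_gt0.
move=> K cK; have mK : measurable (K : set (borel T)) by exact: borel_compact.
have [r r0 Kr] := bounded_compact point cK.
pose dl n : R := (n.+1%:R^-1)%R.
have dl0 n : (0 < dl n)%R by rewrite invr_gt0 ltr0n.
have key n : \int[sigma]_(x in K) trunc_potential sigma D (dl n) K x <=
  C%:E * sigma K.
  have test_n z (s : R) := test (dl n) z s (dl0 n).
  exact: (trunc_energy_le lcT hT scT sigma_lf kappa1 (dl0 n) c1 c0 Dsym Dtri oB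
    (klsc (dl0 n)) growth test_n r0 mK Kr).
have kn0 n x y : 0 <= trunc_kernel D (dl n) x y.
  by rewrite trunc_kernelE// le_min G0 lee_fin invr_ge0 ltW.
have Gk x y : G x y <= limn_einf (fun n => trunc_kernel D (dl n) x y).
  rewrite leNgt; apply/negP => /ereal_between[|s ks sG].
    by apply: limn_einf_ge_near; apply: nearW.
  suff : s%:E <= limn_einf (fun n =>
    trunc_kernel D (dl n) x y) by rewrite leNgt ks.
  (* A value [s] below [G x y] is below the truncated kernel as soon as the cap [n.+1] exceeds
     it. *)
  apply: limn_einf_ge_near; exists (Num.truncn s) => // n /= sn.
  rewrite trunc_kernelE// le_min (ltW sG)/= lee_fin invrK.
  by rewrite (le_trans (ltW (truncnS_gt s)))// ler_nat.
rewrite /energy; apply: (@le_trans _ _ (\int[sigma]_(x in K)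
    limn_einf (fun n => trunc_potential sigma D (dl n) K x))).
  apply: ge0_le_integralW => x _; first exact: integral_ge0.
  apply: (@le_trans _ _ (\int[sigma]_(y in K) limn_einf (fun n =>
    trunc_kernel D (dl n) x y))).
    by apply: ge0_le_integralW => // y _; rewrite Gsym.
  apply: fatou => // n.
  by apply: measurable_funTS; apply: lsc_measurable;
    exact: (lsc_sectionl (klsc (dl0 n))).
apply: le_trans; first apply: fatou => //.
- move=> n; apply: measurable_funTS; apply: lsc_measurable.
  exact: (lsc_potential (klsc (dl0 n)) (kn0 n) scT mK).
- by move=> n x _; exact: integral_ge0.
by apply: limn_einf_le_near; apply: nearW.
Qed.

End quasi_metric_kernels.

(** * Equivalence of the weak-type, strong-type and energy conditions *)

Theorem theorem6p5 (R : realType) (T : ptopologicalType)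
    (lcT : locally_compact [set: T]) (hT : hausdorff_space T)
    (scT : @second_countable T)
    (sigma : {measure set (borel T) -> \bar R})
    (sigma_lf : locally_finite sigma)
    (G : T -> T -> \bar R)
    (G_ge0 : forall x y : T, 0 <= G x y)
    (G_lsc : lower_semicontinuous (fun z : T * T => G z.1 z.2))
    (G_qs : quasi_symmetric G)
    (G_wmp : exists2 h : R, (1 <= h)%R & weak_maximum_principle G h) :
  [<-> weak_type_bound G sigma;
       strong_type_bound G sigma;
       energy_bound_on_compacts G sigma] /\
  ((exists2 kappa : R, (0 < kappa)%R & quasi_metric_kernel G kappa) ->
   [<-> weak_type_bound G sigma;
        strong_type_bound G sigma;
        energy_bound_on_compacts G sigma;
        finite_on_balls G sigma /\ energy_bound_on_balls G sigma]).
Proof.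
have [h h1 wmp] := G_wmp.
have weak_strong : weak_type_bound G sigma -> strong_type_bound G sigma.
  by move=> [c c0 weak];
    exact: (weak_type_strong_type lcT hT scT sigma_lf G_ge0 G_lsc h1 wmp c0
      weak).
have strong_energy := strong_type_energy_bound lcT hT scT sigma_lf G_ge0 G_lsc
  G_qs.
have energy_weak := energy_bound_weak_type lcT hT scT sigma_lf G_ge0 G_lsc G_qs
  h1 wmp.
have strong_compacts : strong_type_bound G sigma ->
  energy_bound_on_compacts G sigma.
  move=> /strong_energy[c c0 cE]; exists c => // K cK; apply: cE.
    exact: borel_compact.
  exact: compact_finite_measure.
split; first by tfae.
move=> [kappa _ Gqm]; tfae => //.
(* Going round through the strong bound upgrades the energy bound from compact sets to all
   measurable sets of finite measure, and so to balls. *)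
- move=> /energy_weak/weak_strong/strong_energy[c c0 cE].
  exact: (energy_bound_finite_on_balls lcT hT scT sigma_lf G_ge0 G_lsc Gqm c0
    cE).
- move=> [fin balls]; apply: energy_weak.
  exact: (energy_bound_balls_compacts lcT hT scT sigma_lf G_ge0 G_lsc Gqm fin
    balls).
Qed.
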